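(* Let $\beta>1$ be a Pisot number. Then there is a sequence of Borel probability measures $\tau_1,\tau_2,\dots$ on $\mathbb{R}$ with $\dim\tau_n\to1$ as $n\to\infty$, such that every $T_\beta$-invariant Borel probability measure $\nu$ on $[0,1]$ with $0<\dim\nu<1$ resonates with $\tau_n$ for all sufficiently large $n$.
   Context: A Pisot number is an algebraic integer $\beta>1$ whose conjugates have modulus $<1$ (integers $\ge2$ included). $T_\beta(x)=\beta x\bmod1$. For a Borel measure $\theta$, $\dim\theta=\inf\{\dim_H A: \theta(A)>0,\ A \text{ Borel}\}$ (lower Hausdorff dimension). Measures $\mu,\nu$ on $\mathbb{R}$ resonate if $\dim(\mu*\nu)<\min\{1,\dim\mu+\dim\nu\}$, and dissonate otherwise. *)

(* Defs.v *)
From HB Require Import structures.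
From mathcomp Require Import all_boot all_order all_algebra.
From mathcomp Require Import all_classical all_reals all_analysis.
From mathcomp Require Import complex.

Set Implicit Arguments.
Unset Strict Implicit.
Unset Printing Implicit Defensive.

Import Order.TTheory GRing.Theory Num.Theory.
Local Open Scope classical_set_scope.
Local Open Scope ring_scope.

(* Pisot number: an algebraic integer b > 1 (root of a monic integer
   polynomial p, irreducible over Q, i.e. p is its minimal polynomial)
   all of whose other (complex) conjugates have modulus < 1. *)
Definition pisot (R : realType) (b : R) : Prop :=
  1 < b /\
  exists p : {poly int},
    [/\ p \is monic,
        irreducible_poly (map_poly (intr : int -> rat) p),
        root (map_poly (intr : int -> R) p) b &
        forall z : R[i], root (map_poly (intr : int -> R[i]) p) z ->
          z != (b%:C)%C -> `|z| < 1].

Definition Tbeta (R : realType) (b : R) (x : R) : R :=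
  b * x - (Num.floor (b * x))%:~R.

(* diameter of a subset of R (only used for nonempty bounded sets) *)
Definition diam (R : realType) (U : set R) : \bar R :=
  ereal_sup [set (`|x - y|)%:E | x in U & y in U].

Definition diam_pow (R : realType) (s : R) (U : set R) : \bar R :=
  if U == set0 then 0%E else ((fine (diam U)) `^ s)%:E.

Definition hausdorff_delta (R : realType) (s delta : R) (A : set R) : \bar R :=
  ereal_inf [set (\sum_(0 <= i <oo) diam_pow s (U i))%E
            | U in [set U : nat -> set R |
                    A `<=` \bigcup_i U i /\
                    forall i, (diam (U i) <= delta%:E)%E]].

(* s-dimensional Hausdorff outer measure: limit as delta -> 0+
   (= sup over delta > 0, by monotonicity) *)
Definition hausdorff_measure (R : realType) (s : R) (A : set R) : \bar R :=
  ereal_sup [set hausdorff_delta s delta A | delta in [set d : R | 0 < d]].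

Definition hausdorff_dim (R : realType) (A : set R) : \bar R :=
  ereal_inf [set s%:E | s in [set s : R | 0 <= s /\ hausdorff_measure s A = 0%E]].

Definition dim_meas (R : realType) (theta : set R -> \bar R) : \bar R :=
  ereal_inf [set hausdorff_dim A | A in [set A : set R | measurable A /\ (0 < theta A)%E]].

Definition convolution (R : realType) (mu nu : {measure set R -> \bar R})
  : set R -> \bar R :=
  fun A => (\int[mu]_x nu [set y | A (x + y)%R])%E.

Definition resonate (R : realType) (mu nu : {measure set R -> \bar R}) : Prop :=
  (dim_meas (convolution mu nu) < mine 1%E (dim_meas mu + dim_meas nu))%E.

Definition dissonate (R : realType) (mu nu : {measure set R -> \bar R}) : Prop :=
  ~ resonate mu nu.

Definition Tinvariant (R : realType) (b : R) (nu : set R -> \bar R) : Prop :=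
  forall A : set R, measurable A -> nu (Tbeta b @^-1` A) = nu A.

(* Main.v *)
Require Import Defs.
From HB Require Import structures.
From mathcomp Require Import all_boot all_order all_algebra.
From mathcomp Require Import all_classical all_reals all_analysis measurable_realfun.
From mathcomp Require Import complex separable polyorder.
From mathcomp Require Import ring lra zify.
Import Order.TTheory GRing.Theory Num.Theory.
Import numFieldNormedType.Exports.
Local Open Scope classical_set_scope.
Local Open Scope ring_scope.

(* Write u in [0,1) in its greedy b-expansion and let tau_n be the law of the
   number obtained from a uniform u by erasing the digits whose position lies
   in S = U_j [p 2^j, (p+1) 2^j), where p = n+1.  Since b is Pisot, two distinct
   sums of b^-i (i <= r) with bounded integer digits differ by at least c b^-r
   (the norm of a nonzero algebraic integer is at least 1).  Hence an interval
   of length b^-N contains boundedly many truncated values of the erased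
   expansion, and each of them comes from at most (floor b + 1)^|S cap [0,N)|
   cylinders of length b^-N; as |S cap [0,N)| <= 1 + 2N/p, the measure tau_n is
   Frostman with exponent 1 - O(1/p).
   If nu is invariant and dim nu < 1, then nu is not Frostman of exponent 1, so
   some interval I meeting boundedly many words of some length L has
   nu(I) = c much larger than b^-L.  Split [p 2^j, (p+1) 2^j) into k blocks of
   length L.  By invariance, with nu-probability at least c/2, a proportion c/2
   of the blocks of y carries one of these words; the erased digits of tau_n
   leave them untouched in x + y.  By separation there are at most
   C b^N exp(-kc/2) possible values of such x + y at scale b^-N, with k
   proportional to N, and the limsup over j of the corresponding sets has
   positive tau_n * nu measure and dimension less than 1. *)

Set Implicit Arguments.
Unset Strict Implicit.
Unset Printing Implicit Defensive.

(** * Separation of integer polynomials at a Pisot number *)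

(* Conjugation of the multiplication-by-P matrix on Z[X]/(p) by the Vandermonde
   matrix of the roots shows that the norm of P is the determinant of an
   integer matrix. *)
Lemma prod_horner_roots_int (F : fieldType) (p P : {poly int}) (r : seq F) :
  p \is monic -> map_poly intr p = \prod_(z <- r) ('X - z%:P) -> uniq r ->
  exists m : int, \prod_(z <- r) (map_poly intr P).[z] = m%:~R.
Proof.
move=> pmon pr ur; set d := size r.
have sp : size p = d.+1.
  have: size (map_poly (intr : int -> F) p) = d.+1.
    by rewrite pr size_prod_XsubC.
  by rewrite size_map_poly_id0 // (monicP pmon) rmorph1 oner_neq0.
pose rem i := Pdiv.Ring.rmodp ('X^i * P) p.
have srem i : (size (rem i) <= d)%N.
  by rewrite -ltnS -sp Pdiv.Ring.ltn_rmodp -size_poly_gt0 sp.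
pose A := \matrix_(i < d, k < d) (rem i)`_k.
pose a : 'rV[F]_d := \row_(j < d) r`_j.
have hrem i (j : 'I_d) : (map_poly intr (rem i)).[r`_j] = r`_j ^+ i * (map_poly intr P).[r`_j].
  have := Pdiv.RingMonic.rdivp_eq pmon ('X^i * P); rewrite -/(rem i).
  move=> /(congr1 (fun q => (map_poly (intr : int -> F) q).[r`_j])).
  rewrite !rmorphM rmorphD rmorphM /= map_polyXn hornerM hornerXn => ->.
  rewrite hornerD hornerM [X in _ * X](_ : _ = 0) ?mulr0 ?add0r //.
  by apply/eqP; rewrite -/(root _ _) pr root_prod_XsubC mem_nth.
have AV : map_mx intr A *m Vandermonde d a =
    Vandermonde d a *m diag_mx (\row_(j < d) (map_poly intr P).[r`_j]).
  apply/matrixP => i j; rewrite mul_mx_diag !mxE -hrem.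
  rewrite (@horner_coef_wide _ d); last first.
    by rewrite (leq_trans (size_poly _ _)).
  by apply: eq_bigr => k _; rewrite !mxE coef_map.
have V0 : \det (Vandermonde d a) != 0.
  rewrite det_Vandermonde; apply/prodf_neq0 => i _; apply/prodf_neq0 => j ij.
  by rewrite !mxE subr_eq0 nth_uniq // gtn_eqF.
exists (\det A).
have /(congr1 determinant) := AV; rewrite !det_mulmx det_diag [RHS]mulrC => /(mulIf V0).
rewrite det_map_mx => ->; rewrite (big_nth 0) big_mkord.
by apply: eq_bigr => j _; rewrite mxE.
Qed.

(** Inside the unit disc the value is dominated by a geometric series, so the bound is uniform in
    the degree of [P]. *)
Lemma norm_horner_le (F : numFieldType) (D : nat) (P : {poly int}) (z : F) :
  `|z| < 1 -> (forall i, `|P`_i| <= D%:Z) ->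
  `|(map_poly intr P).[z]| <= D%:R / (1 - `|z|).
Proof.
move=> z1 PD; have z1' : 0 < 1 - `|z| by rewrite subr_gt0.
rewrite horner_coef (le_trans (ler_norm_sum _ _ _)) //.
set n := size _; have geo : (1 - `|z|) * (\sum_(i < n) `|z| ^+ i) = 1 - `|z| ^+ n.
  by rewrite -[LHS]opprK -mulNr opprB -subrX1 opprB.
rewrite ler_pdivlMr // (@le_trans _ _ (D%:R * (1 - `|z| ^+ n))) //.
  rewrite -geo mulrCA [leRHS]mulrC (ler_wpM2r (ltW z1')) // mulr_sumr ler_sum // => i _.
  rewrite normrM normrX ler_wpM2r ?exprn_ge0 //.
  by rewrite coef_map /= -intr_norm -[D%:R]/((Posz D)%:~R) ler_int.
by rewrite ler_piMr // gerBl exprn_ge0.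
Qed.

(** In characteristic 0 the derivative of a nonconstant polynomial is nonzero of smaller degree, so
    the irreducible [p] cannot divide it. *)
Lemma irreducible_separable_rat (p : {poly rat}) :
  irreducible_poly p -> separable_poly p.
Proof.
move=> ip; rewrite unlock /= irreducible_poly_coprime //.
case: ip => sp _; apply/negP => /dvdp_leq.
have sp' : size p^`() = (size p).-1 by rewrite size_deriv.
rewrite -size_poly_gt0 sp' => /(_ _); move: sp; case: (size p) => [|[|n]] //= _.
by move=> /(_ isT); rewrite ltnn.
Qed.

Lemma map_poly_intr_ratr (F : numFieldType) (q : {poly int}) :
  map_poly (intr : int -> F) q = map_poly ratr (map_poly (intr : int -> rat) q).
Proof.
by rewrite -map_poly_comp; apply: eq_map_poly => i /=; rewrite ratr_int.
Qed.

(** The product of the values of [P] over all roots of [p] is a nonzero integer, hence at least 1 in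
    modulus. The factors at the roots other than [b] are bounded in terms of [D] alone, and [K]
    collects these bounds. *)
Lemma root_separation (F : numClosedFieldType) (p : {poly int}) (b : F) (D : nat) :
  p \is monic -> irreducible_poly (map_poly (intr : int -> rat) p) ->
  root (map_poly intr p) b ->
  (forall z : F, root (map_poly intr p) z -> z != b -> `|z| < 1) ->
  exists2 K : F, 0 < K & forall P : {poly int}, (forall i, `|P`_i| <= D%:Z) ->
    (map_poly intr P).[b] != 0 -> 1 <= `|(map_poly intr P).[b]| * K.
Proof.
move=> pmon pirr pb pconj; set pC := map_poly (intr : int -> F) p.
have [r] := closed_field_poly_normal pC.
have /monicP -> : pC \is monic by rewrite monic_map.
rewrite scale1r => pr.
have ur : uniq r.
  rewrite -separable_prod_XsubC -pr /pC map_poly_intr_ratr separable_map.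
  exact: irreducible_separable_rat.
have br : b \in r by rewrite -root_prod_XsubC -pr.
have rE z : z \in r -> root pC z by rewrite pr root_prod_XsubC.
(* The summand 1 keeps each factor positive even when [D] is 0. *)
exists (\prod_(z <- r | z != b) (1 + D%:R / (1 - `|z|))).
  rewrite big_seq_cond; apply: prodr_gt0 => z /andP[/rE zr zb].
  by rewrite ltr_pwDl // divr_ge0 // subr_ge0 ltW // pconj.
move=> P PD Pb.
(* If [p] divided [P] then [P] would vanish at [b]; so [p], being irreducible, is coprime to [P],
   and they share no root. *)
have Pz z : z \in r -> (map_poly (intr : int -> F) P).[z] != 0.
  move=> zr; rewrite map_poly_intr_ratr; apply: (@coprimep_root _ pC); last exact: rE.
  rewrite /pC map_poly_intr_ratr coprimep_map irreducible_poly_coprime //.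
  apply: contra Pb => pP.
  have : map_poly (intr : int -> F) p %| map_poly (intr : int -> F) P.
    by rewrite (map_poly_intr_ratr _ p) (map_poly_intr_ratr _ P) dvdp_map.
  by move=> /dvdpP[q ->]; rewrite hornerM (rootP pb) mulr0.
have [m mE] := prod_horner_roots_int P pmon pr ur.
have m0 : m != 0.
  apply/negP => /eqP m0; move: mE; rewrite m0 => /eqP.
  by rewrite prodf_seq_eq0 => /seq.hasP[z /Pz] /negPf /= ->.
have : 1 <= `|\prod_(z <- r) (map_poly (intr : int -> F) P).[z]|.
  by rewrite mE -intr_norm -[1]/(1%:~R) ler_int -gtz0_ge1 normr_gt0.
rewrite (bigD1_seq b) //= normrM normr_prod => /le_trans; apply.
rewrite ler_wpM2l // big_seq_cond [leRHS]big_seq_cond.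
apply: ler_prod => z /andP[/rE zr zb]; rewrite normr_ge0 /=.
by rewrite (le_trans (norm_horner_le (pconj _ zr zb) PD)) // lerDr.
Qed.

Lemma pisot_separation (R : realType) (b : R) (D : nat) : pisot b ->
  exists2 c : R, 0 < c & forall P : {poly int}, (forall i, `|P`_i| <= D%:Z) ->
    (map_poly intr P).[b] != 0 -> c <= `|(map_poly intr P).[b]|.
Proof.
move=> [b1 [p [pmon pirr pb pconj]]].
have mapb (q : {poly int}) : (map_poly (intr : int -> R[i]) q).[(b%:C)%C]
    = ((map_poly (intr : int -> R) q).[b]%:C)%C.
  rewrite -[RHS]horner_map /= -map_poly_comp; congr (_.[_]).
  by apply: eq_map_poly => i /=; rewrite rmorph_int.
have pbC : root (map_poly (intr : int -> R[i]) p) (b%:C)%C.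
  by rewrite /root mapb; move: pb => /rootP ->.
have [K K0 PK] := root_separation D pmon pirr pbC pconj.
(* A positive element of [R[i]] has imaginary part 0, so the constant descends to [R]. *)
have [k k0 kK] : exists2 k : R, 0 < k & K = (k%:C)%C.
  exists (complex.Re K); first by move: K0; rewrite ltcE /= => /andP[].
  by move: K0; case: (K) => x y; rewrite ltcE /= => /andP[/eqP -> _].
exists k^-1; first by rewrite invr_gt0.
move=> P PD Pb.
have /(PK P PD) : (map_poly (intr : int -> R[i]) P).[(b%:C)%C] != 0.
  by rewrite mapb (inj_eq (@complexI R)).
rewrite mapb kK normc_def /= expr0n addr0 sqrtr_sqr -rmorphM lecR => h.
by rewrite -[k^-1]mul1r ler_pdivrMr.
Qed.

(** * Hausdorff dimension *)

Lemma dim_meas_ge0 (R : realType) (mu : set R -> \bar R) : (0 <= dim_meas mu)%E.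
Proof.
apply: le_ereal_inf_tmp => _ [A [mA A0] <-]; apply: le_ereal_inf_tmp => _ [s [s0 _] <-].
by rewrite lee_fin.
Qed.

Lemma dim_meas_le (R : realType) (mu : set R -> \bar R) (A : set R) (s : R) :
  0 <= s -> measurable A -> (0 < mu A)%E -> hausdorff_measure s A = 0%E ->
  (dim_meas mu <= s%:E)%E.
Proof.
move=> s0 mA A0 H; apply: (@le_trans _ _ (hausdorff_dim A)).
  by apply: ereal_inf_lbound; exists A.
by apply: ereal_inf_lbound; exists s.
Qed.

Lemma diam_ge (R : realType) (U : set R) (x y : R) :
  U x -> U y -> ((`|x - y|)%:E <= diam U)%E.
Proof. by move=> Ux Uy; apply: ereal_sup_ubound; exists x => //; exists y. Qed.

Lemma diam_le (R : realType) (U : set R) (d : \bar R) :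
  (forall x y, U x -> U y -> ((`|x - y|)%:E <= d)%E) -> (diam U <= d)%E.
Proof. by move=> h; apply: ge_ereal_sup => _ [x Ux [y Uy <-]]; exact: h. Qed.

Lemma diam_pow_ge0 (R : realType) (s : R) (U : set R) : (0 <= diam_pow s U)%E.
Proof. by rewrite /diam_pow; case: ifPn => // _; rewrite lee_fin powR_ge0. Qed.

(** Mass distribution principle: a covering set of diameter [d] lies in the interval of radius [d]
    about any of its points, so a cover of small [s']-cost with [s' < s] forces small measure. *)
Lemma frostman_dim_meas (R : realType) (mu : {measure set R -> \bar R}) (C s : R) :
  0 <= C ->
  (forall x d : R, 0 < d -> d <= 1 -> (mu `[(x - d)%R, (x + d)%R]%classic <= (C * d `^ s)%:E)%E) ->
  (s%:E <= dim_meas mu)%E.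
Proof.
move=> C0 hmu; apply: le_ereal_inf_tmp => _ [A [mA A0] <-].
apply: le_ereal_inf_tmp => _ [s' [s'0 HA] <-]; rewrite lee_fin leNgt; apply/negP => ss'.
have s0 : 0 < s by exact: le_lt_trans ss'.
have C1 : 0 < C + 1 by rewrite ltr_wpDl.
(* A covering set may be a single point, where the hypothesis for [d > 0] does not apply directly;
   points are null because [s > 0]. Dividing by [C + 1] allows [C = 0]. *)
have mu1 (x : R) : mu [set x] = 0%E.
  apply/eqP; rewrite eq_le measure_ge0 andbT; apply/lee_addgt0Pr => e e0.
  rewrite add0e; pose d := Num.min 1 ((e / (C + 1)) `^ s^-1).
  have d0 : 0 < d by rewrite lt_min ltr01 powR_gt0 // divr_gt0.
  apply: (@le_trans _ _ (mu `[(x - d)%R, (x + d)%R]%classic)).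
    apply: le_measure; rewrite ?inE //=.
    by move=> y -> /=; rewrite in_itv /= lerBlDr !lerDl ltW.
  apply: (le_trans (hmu x d d0 _)); first by rewrite ge_min lexx.
  rewrite lee_fin; apply: (@le_trans _ _ (C * (e / (C + 1)))).
    apply: ler_wpM2l => //.
    have -> : e / (C + 1) = ((e / (C + 1)) `^ s^-1) `^ s.
      by rewrite -powRrM mulVf ?gt_eqF // powRr1 // divr_ge0 // ltW.
    by rewrite ge0_ler_powR ?nnegrE ?powR_ge0 ?(ltW d0) ?(ltW s0) // ge_min lexx orbT.
  by rewrite mulrA ler_pdivrMr // mulrC ler_wpM2l ?ltW // ltrDl.
(* Covers at scale 1 suffice, since the measure bound holds for all [d <= 1]. *)
have hd : (hausdorff_delta s' 1 A <= 0)%E.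
  by rewrite -HA; apply: ereal_sup_ubound; exists 1 => //=.
have : (mu A <= 0)%E; last by rewrite leNgt A0.
apply/lee_addgt0Pr => e e0; rewrite add0e.
have : (hausdorff_delta s' 1 A < (e / (C + 1))%:E)%E.
  by apply: (le_lt_trans hd); rewrite lte_fin divr_gt0.
move=> /ereal_inf_lt[_ [U [AU dU] <-]] sU.
have mF i : exists F : set R, [/\ measurable F, U i `<=` F &
    (mu F <= C%:E * diam_pow s' (U i))%E].
  have [->|/set0P[x Ux]] := eqVneq (U i) set0.
    by exists set0; split => //; rewrite measure0 mule_ge0 ?diam_pow_ge0 // lee_fin.
  have d0 : (0 <= diam (U i))%E by rewrite (le_trans _ (diam_ge Ux Ux)) // subrr normr0.
  have dfin : diam (U i) \is a fin_num.
    by rewrite ge0_fin_numE // (le_lt_trans (dU i)) // ltry.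
  set d := fine (diam (U i)).
  have dE : diam (U i) = d%:E by rewrite fineK.
  have d1 : d <= 1 by rewrite -lee_fin -dE.
  have UF : U i `<=` `[(x - d)%R, (x + d)%R]%classic.
    move=> y Uy /=; rewrite in_itv /=; have := diam_ge Ux Uy.
    by rewrite dE lee_fin ler_norml => /andP[]; lra.
  have U0 : U i != set0 by apply/set0P; exists x.
  exists `[(x - d)%R, (x + d)%R]%classic; split => //.
  rewrite /diam_pow (negbTE U0) -/d -EFinM.
  have : 0 <= d by rewrite -lee_fin -dE.
  rewrite le_eqVlt => /predU1P[<-|dp].
    rewrite subr0 addr0 set_itv1 mu1 lee_fin mulr_ge0 // powR_ge0 //.
  apply: (le_trans (hmu x d dp d1)); rewrite lee_fin ler_wpM2l //.
  by rewrite ger_powR ?dp // ltW.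
have [F HF] := choice mF.
have AF : A `<=` \bigcup_i F i.
  by move=> y /AU[i _ Uy]; exists i => //; have [_ + _] := HF i; apply.
apply: (le_trans (measure_sigma_subadditive mu _ mA AF)).
  by move=> i; have [] := HF i.
apply: (@le_trans _ _ (\sum_(0 <= i <oo) (C%:E * diam_pow s' (U i)))%E).
  by apply: lee_nneseries => // i _; have [] := HF i.
rewrite nneseriesZl; last by move=> i _; exact: diam_pow_ge0.
apply: (@le_trans _ _ (C%:E * (e / (C + 1))%:E)%E).
  by rewrite lee_wpmul2l ?lee_fin // ltW.
rewrite -EFinM lee_fin mulrA ler_pdivrMr // mulrC ler_wpM2l ?ltW // ltrDl //.
Qed.

Lemma nneseries_geometric (R : realType) (a q : R) : 0 <= a -> 0 < q < 1 ->
  (\sum_(0 <= j <oo) (a * q ^+ j)%:E)%E = (a / (1 - q))%:E.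
Proof.
move=> a0 /andP[q0 q1]; apply: cvg_lim => //.
apply: cvg_EFin; first by apply: nearW => n; rewrite sumEFin.
rewrite (_ : fine \o _ = series (geometric a q)).
  by apply: cvg_geometric_series; rewrite ger0_norm // ltW.
by apply/funext => n /=; rewrite sumEFin.
Qed.

(** Borel-Cantelli covering: level [j] costs at most [C q^j], so the intervals of all levels from
    [J] on cover [A] at a total cost that is the tail of a geometric series. *)
Lemma hausdorff_measure_limsup0 (R : realType) (A : set R) (s C q : R)
    (r : nat -> R) (l : nat -> seq R) :
  0 <= s -> 0 < q < 1 -> 0 <= C -> (forall j, 0 <= r j) ->
  (forall j, r j <= C * q ^+ j) ->
  (forall j, (size (l j))%:R * r j `^ s <= C * q ^+ j) ->
  (forall J, A `<=` \bigcup_(j in [set j | (J <= j)%N])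
     \bigcup_(v in [set` l j]) `[v, v + r j]%classic) ->
  hausdorff_measure s A = 0%E.
Proof.
move=> s0 q01 C0 r0 rq lq AU; have /andP[q0 q1] := q01.
apply/eqP; rewrite eq_le; apply/andP; split; last first.
  apply: (@le_trans _ _ (hausdorff_delta s 1 A)).
    apply: le_ereal_inf_tmp => _ [U _ <-]; apply: nneseries_ge0 => i _ _.
    exact: diam_pow_ge0.
  by apply: ereal_sup_ubound; exists 1 => //=.
apply: ge_ereal_sup => _ [d /= d0 <-]; apply/lee_addgt0Pr => e e0; rewrite add0e.
(* From level [J] on, the diameters are at most [d] and the total cost is at most [e]. *)
have [J JC Jd] : exists2 J, C * q ^+ J <= d & C * q ^+ J / (1 - q) <= e.
  have : (geometric C q x @[x --> \oo] --> (0:R))%classic.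
    by apply: cvg_geometric; rewrite ger0_norm ?(ltW q0).
  move/cvgrPdist_le => h.
  have me : 0 < Num.min d (e * (1 - q)) by rewrite lt_min d0 mulr_gt0 // subr_gt0.
  have [J _ /(_ J (leqnn J))] := h _ me.
  rewrite /= sub0r normrN ger0_norm ?mulr_ge0 ?exprn_ge0 ?(ltW q0) // le_min.
  move=> /andP[h1 h2]; exists J => //.
  by rewrite ler_pdivrMr // subr_gt0.
have [f fbij] : exists f : nat -> nat * nat, set_bij [set: nat] [set: nat * nat] f.
  by apply/card_set_bijP; rewrite card_eq_sym card_nat2.
(* The pair consists of a level, counted from [J], and an index in its list. Indices past the end
   give the empty set, whose [diam_pow] is 0. *)
pose V (k : nat * nat) : set R :=
  if (k.2 < size (l (J + k.1)))%N
  then `[(l (J + k.1)%N)`_k.2, (l (J + k.1)%N)`_k.2 + r (J + k.1)%N]%classic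
  else set0.
pose g (j i : nat) : \bar R :=
  if (i < size (l (J + j)))%N then (r (J + j)%N `^ s)%:E else 0%E.
have dV k : (diam (V k) <= (r (J + k.1)%N)%:E)%E.
  apply: diam_le => x y; rewrite /V; case: ifP => // _ /=.
  rewrite !in_itv /= lee_fin ler_norml => /andP[? ?] /andP[? ?].
  by apply/andP; split; lra.
have gV k : (diam_pow s (V k) <= g k.1 k.2)%E.
  rewrite /diam_pow /g; case: ifPn => [_|V0].
    by case: ifP => // _; rewrite lee_fin powR_ge0.
  have := V0; rewrite {1}/V; case: ifP; last by rewrite eqxx.
  move=> kl _; have /set0P[x Vx] := V0.
  have D0 : (0 <= diam (V k))%E by rewrite (le_trans _ (diam_ge Vx Vx)) // subrr normr0.
  rewrite lee_fin ge0_ler_powR ?nnegrE ?fine_ge0 //.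
  by rewrite -[leRHS]/(fine (r (J + k.1)%N)%:E) fine_le // ge0_fin_numE // (le_lt_trans (dV k)) // ltry.
have g0 j i : (0 <= g j i)%E.
  by rewrite /g; case: ifP => // _; rewrite lee_fin powR_ge0.
apply: (@le_trans _ _ (\sum_(0 <= i <oo) diam_pow s (V (f i)))%E).
  apply: ereal_inf_lbound; exists (V \o f) => //=; split.
    move=> x /(AU J)[j /= Jj [v /= vl vx]].
    have [_ _ fsurj] := fbij.
    have [m _ fm] := fsurj (j - J, index v (l j))%N I.
    exists m => //; rewrite fm /V /= subnKC // index_mem vl nth_index //.
  move=> i; apply: (le_trans (dV _)); rewrite lee_fin (le_trans (rq _)) //.
  apply: le_trans JC; rewrite ler_wpM2l // exprD ler_piMr ?exprn_ge0 ?(ltW q0) //.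
  by rewrite exprn_ile1 ?(ltW q0) ?(ltW q1).
rewrite nneseries_esumT; last by move=> i; exact: diam_pow_ge0.
rewrite -(@reindex_esum R nat (nat * nat)%type setT setT f (fun k => diam_pow s (V k))) //.
apply: (@le_trans _ _ (\esum_(k in [set: nat * nat]) g k.1 k.2)%E).
  by apply: le_esum => k _; exact: gV.
have -> : [set: nat * nat] = [set: nat] `*`` (fun=> [set: nat]).
  by apply/seteqP; split => // x _.
rewrite -(@esum_esum R nat nat setT (fun=> setT) g) //.
rewrite -nneseries_esumT; last by move=> j; apply: esum_ge0.
apply: le_trans (_ : ((C * q ^+ J / (1 - q))%:E <= _)%E); last by rewrite lee_fin.
rewrite -nneseries_geometric ?mulr_ge0 ?exprn_ge0 ?(ltW q0) //.
apply: lee_nneseries => [j _ _|j _]; first exact: esum_ge0.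
rewrite -nneseries_esumT // (nneseries_split 0 (size (l (J + j)%N))) // add0n.
rewrite (@eseries0 _ (g j)); last first.
  by move=> i; rewrite /g leqNgt => /negbTE -> .
rewrite adde0 (eq_big_nat _ _ (F2 := fun=> (r (J + j)%N `^ s)%:E)); last first.
  by move=> i /andP[_ h]; rewrite /g h.
rewrite sumEFin sumr_const_nat subn0 -mulr_natl lee_fin.
by apply: (le_trans (lq _)); rewrite exprD mulrA.
Qed.

(** * Sums with bounded digits *)

Definition beta_val (R : realType) (b : R) (r : nat) (e : nat -> nat) : R :=
  \sum_(i < r) (e i)%:R * b ^- i.+1.

Lemma beta_valD (R : realType) (b : R) (m n : nat) (e : nat -> nat) :
  beta_val b (m + n) e = beta_val b m e + b ^- m * beta_val b n (fun i => e (m + i)%N).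
Proof.
rewrite /beta_val big_split_ord /=; congr (_ + _); rewrite mulr_sumr.
by apply: eq_bigr => i _; rewrite -addnS exprD invfM mulrCA.
Qed.

Lemma beta_valS (R : realType) (b : R) (r : nat) (e : nat -> nat) :
  beta_val b r.+1 e = beta_val b r e + (e r)%:R * b ^- r.+1.
Proof. by rewrite /beta_val big_ord_recr. Qed.

Lemma beta_val_add (R : realType) (b : R) (r : nat) (e e' : nat -> nat) :
  beta_val b r (fun i => e i + e' i)%N = beta_val b r e + beta_val b r e'.
Proof.
by rewrite /beta_val -big_split; apply: eq_bigr => i _; rewrite natrD mulrDl.
Qed.

Lemma eq_beta_val (R : realType) (b : R) (r : nat) (e e' : nat -> nat) :
  (forall i, (i < r)%N -> e i = e' i) -> beta_val b r e = beta_val b r e'.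
Proof. by move=> h; apply: eq_bigr => i _; rewrite h. Qed.

Lemma beta_val_le (R : realType) (b : R) (e : nat -> nat) (m n : nat) :
  0 < b -> (m <= n)%N -> beta_val b m e <= beta_val b n e.
Proof.
move=> b0 /subnKC <-; rewrite beta_valD lerDl mulr_ge0 ?invr_ge0 ?exprn_ge0 ?(ltW b0) //.
by apply: sumr_ge0 => i _; rewrite mulr_ge0 // invr_ge0 exprn_ge0 ?(ltW b0).
Qed.

Lemma beta_val_tail (R : realType) (b : R) (D : nat) (e : nat -> nat) (m n : nat) :
  1 < b -> (forall i, (e i <= D)%N) -> (m <= n)%N ->
  beta_val b n e <= beta_val b m e + D%:R / (b - 1) * b ^- m.
Proof.
move=> b1 eD /subnKC <-; have b0 : 0 < b by lra.
have K0 : 0 <= D%:R / (b - 1) by rewrite divr_ge0 //; lra.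
(* The partial sum plus the full geometric tail after it is nonincreasing in the length; this
   stronger statement is the one proved by induction. *)
apply: (@le_trans _ _ (beta_val b (m + (n - m)) e + D%:R / (b - 1) * b ^- (m + (n - m)))).
  by rewrite lerDl mulr_ge0 // invr_ge0 exprn_ge0 // ltW.
elim: (n - m)%N => [|k IH]; first by rewrite addn0.
apply: le_trans IH; rewrite addnS beta_valS -addrA lerD2l.
have -> : D%:R / (b - 1) * b ^- (m + k) =
    D%:R * b ^- (m + k).+1 + D%:R / (b - 1) * b ^- (m + k).+1.
  rewrite exprS invfM; field.
  by rewrite expf_neq0 ?gt_eqF //; lra.
by rewrite lerD2r ler_wpM2r ?invr_ge0 ?exprn_ge0 ?(ltW b0) // ler_nat.
Qed.

(** Multiplied by [b ^+ r], the difference of the two sums is the value at [b] of an integer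
    polynomial with coefficients bounded by [D]. *)
Lemma beta_val_separation (R : realType) (b : R) (D : nat) : pisot b ->
  exists2 c : R, 0 < c & forall r (e e' : nat -> nat),
    (forall i, (e i <= D)%N) -> (forall i, (e' i <= D)%N) ->
    beta_val b r e != beta_val b r e' ->
    c * b ^- r <= `|beta_val b r e - beta_val b r e'|.
Proof.
move=> hb; have [c c0 hc] := pisot_separation D hb; exists c => // r e e' eD e'D.
have b1 : 1 < b by case: hb.
have b0 : 0 < b by lra.
(* Multiplying by [b ^+ r] reverses the order of the digits: digit [i] becomes the coefficient of
   degree [r - i - 1]. *)
pose P : {poly int} := \poly_(k < r) ((e (r - k.+1)%N)%:Z - (e' (r - k.+1)%N)%:Z).
have PD i : `|P`_i| <= D%:Z.
  rewrite coef_poly; case: ifP => // _; rewrite ler_norml.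
  by have := eD (r - i.+1)%N; have := e'D (r - i.+1)%N; lia.
have Pb : (map_poly intr P).[b] = b ^+ r * (beta_val b r e - beta_val b r e').
  rewrite (@horner_coef_wide _ r); last first.
    by rewrite (leq_trans (size_poly _ _)) // size_poly.
  rewrite /beta_val -sumrB mulr_sumr (reindex_inj rev_ord_inj) /=.
  apply: eq_bigr => i _; rewrite coef_map coef_poly.
  rewrite (_ : (r - i.+1 < r)%N) /=; last by have := ltn_ord i; lia.
  rewrite (_ : (r - (r - i.+1).+1)%N = i); last by have := ltn_ord i; lia.
  rewrite intrB -mulrBl mulrCA; congr (_ * _).
  have := exprD b (r - i.+1) i.+1; rewrite subnK // => ->.
  by rewrite mulfK // expf_neq0 // gt_eqF.
move=> ne; have : (map_poly intr P).[b] != 0.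
  by rewrite Pb mulf_neq0 ?subr_eq0 // expf_neq0 // gt_eqF.
move=> /(hc P PD); rewrite Pb normrM normrX gtr0_norm // => h.
by rewrite ler_pdivrMr ?exprn_gt0 // mulrC.
Qed.

(** Pigeonhole: the cell index [f] for cells of length [d] is injective on [s]. *)
Lemma size_separated (R : realType) (s : seq R) (x h d : R) :
  0 <= h -> 0 < d -> uniq s -> (forall v, v \in s -> x <= v <= x + h) ->
  (forall v w, v \in s -> w \in s -> v != w -> d <= `|v - w|) ->
  (size s)%:R <= h / d + 1.
Proof.
move=> h0 d0 us sx sd; pose f (v : R) := Num.truncn ((v - x) / d).
have vx v : v \in s -> 0 <= (v - x) / d.
  by move=> /sx /andP[? _]; rewrite divr_ge0 ?subr_ge0 // ltW.
have uf : uniq (map f s).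
  rewrite map_inj_in_uniq // => v w vs ws fvw; apply/eqP; apply: contraT => vw.
  have := sd v w vs ws vw; rewrite leNgt => /negP[].
  have /andP[v1 v2] := truncn_itv (vx v vs).
  have /andP[w1 w2] := truncn_itv (vx w ws).
  move: v1 v2 w1 w2; rewrite -/(f v) -/(f w) fvw.
  rewrite !ler_pdivlMr // !ltr_pdivrMr // -[(f w).+1]addn1 natrD => *.
  by rewrite ltr_norml; apply/andP; split; lra.
have sf : {subset map f s <= iota 0 (Num.truncn (h / d)).+1}.
  move=> _ /mapP[v vs ->]; rewrite mem_iota /= add0n ltnS.
  apply: le_truncn; rewrite ler_pM2r ?invr_gt0 //.
  by have /andP[] := sx v vs; lra.
have := uniq_leq_size uf sf; rewrite size_map size_iota => le.
apply: (@le_trans _ _ (Num.truncn (h / d)).+1%:R); first by rewrite ler_nat.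
by rewrite -addn1 natrD lerD2r truncn_le divr_ge0 // ltW.
Qed.

Lemma beta_val_list (R : realType) (b : R) (D r : nat) : exists s : seq R,
  forall v, v \in s <-> exists2 e, (forall i, (e i <= D)%N) & v = beta_val b r e.
Proof.
elim: r => [|r [s hs]].
  exists [:: 0] => v; rewrite inE; split; first move=> /eqP ->.
    by exists (fun=> 0%N) => //; rewrite /beta_val big_ord0.
  by move=> [e _ ->]; rewrite /beta_val big_ord0.
exists [seq v + d%:R * b ^- r.+1 | v <- s, d <- iota 0 D.+1] => v; split.
  move=> /allpairsP[[w d] [/hs [e eD ->]]]; rewrite mem_iota ltnS => /= dD ->.
  exists (fun i => if i == r then d else e i) => [i|]; first by case: ifP.
  rewrite beta_valS eqxx; congr (_ + _); apply: eq_beta_val => i ir.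
  by rewrite ltn_eqF.
move=> [e eD ->]; rewrite beta_valS; apply/allpairsP; exists (beta_val b r e, e r).
by split; [apply/hs; exists e|rewrite mem_iota ltnS; exact: eD|].
Qed.

(** The list enumerates values rather than digit words: many words may share one value, and distinct
    values are separated by [c * b ^- r]. *)
Lemma beta_val_local_list (R : realType) (b : R) (D : nat) : pisot b ->
  exists2 c : R, 0 < c & forall r (x h : R), 0 <= h -> exists2 s : seq R,
    (size s)%:R <= h * b ^+ r / c + 1 &
    forall e, (forall i, (e i <= D)%N) -> x <= beta_val b r e <= x + h ->
      beta_val b r e \in s.
Proof.
move=> hb; have [c c0 hc] := beta_val_separation D hb; exists c => // r x h h0.
have b0 : 0 < b by case: hb => b1 _; lra.
have [s hs] := beta_val_list b D r.
exists (undup [seq v <- s | x <= v <= x + h]); last first.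
  by move=> e eD xe; rewrite mem_undup mem_filter xe; apply/hs; exists e.
have -> : h * b ^+ r / c = h / (c * b ^- r) by rewrite invfM invrK mulrA mulrAC.
apply: (@size_separated _ _ x) => //; rewrite ?undup_uniq ?divr_gt0 ?exprn_gt0 //.
  by move=> v; rewrite mem_undup mem_filter => /andP[].
move=> v w; rewrite !mem_undup !mem_filter => /andP[_ /hs[e eD ->]].
by move=> /andP[_ /hs[e' e'D ->]]; exact: hc.
Qed.

(** All the values lie in one interval of length [D / (b - 1)]; the extra 1 of the local count is
    absorbed by [b ^+ r >= 1]. *)
Lemma beta_val_global_list (R : realType) (b : R) (D : nat) : pisot b ->
  exists2 C : R, 0 < C & forall r, exists2 s : seq R,
    (size s)%:R <= C * b ^+ r &
    forall e, (forall i, (e i <= D)%N) -> beta_val b r e \in s.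
Proof.
move=> hb; have [c c0 hc] := beta_val_local_list D hb.
have b1 : 1 < b by case: hb.
have K0 : 0 <= D%:R / (b - 1) by rewrite divr_ge0 //; lra.
exists (D%:R / (b - 1) / c + 1); first by rewrite ltr_wpDl // divr_ge0 // ltW.
move=> r; have [s ss hs] := hc r 0 _ K0; exists s.
  apply: (le_trans ss); rewrite mulrDl mul1r mulrAC lerD2l.
  by rewrite exprn_ege1 // ltW.
move=> e eD; apply: hs => //; rewrite add0r; apply/andP; split.
  have := @beta_val_le R b e 0 r; rewrite {1}/beta_val big_ord0; apply => //; lra.
have := beta_val_tail b1 eD (leq0n r).
by rewrite {2}/beta_val big_ord0 add0r expr0 invr1 mulr1.
Qed.

(** Here words are counted, with [D + 1] choices at each position of [S]. This bounds the ways of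
    restoring erased digits. *)
Lemma beta_val_supported_list (R : realType) (b : R) (D : nat) (S : pred nat) (r : nat) :
  exists2 s : seq R, size s = (D.+1 ^ count S (iota 0 r))%N &
    forall e, (forall i, (e i <= D)%N) ->
      beta_val b r (fun i => if S i then e i else 0%N) \in s.
Proof.
elim: r => [|r [s ss hs]].
  by exists [:: 0] => // e _; rewrite /beta_val big_ord0 inE.
exists [seq v + d%:R * b ^- r.+1 | v <- s, d <- if S r then iota 0 D.+1 else [:: 0%N]].
  have -> : iota 0 r.+1 = iota 0 r ++ [:: r] by rewrite -addn1 iotaD.
  rewrite size_allpairs ss count_cat /= addn0 expnD.
  by case: (S r); rewrite /= ?size_iota ?expn1 ?expn0.
move=> e eD; rewrite beta_valS; apply/allpairsP.
exists (beta_val b r (fun i => if S i then e i else 0%N), if S r then e r else 0%N).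
split; [exact: hs| |by []].
by case: (S r) => //; rewrite mem_iota ltnS; exact: eD.
Qed.

(** * Expansions with prescribed blocks *)

Fixpoint all_bitseqs (k : nat) : seq bitseq :=
  if k is k'.+1 then map (cons true) (all_bitseqs k') ++ map (cons false) (all_bitseqs k')
  else [:: [::]].

Lemma mem_all_bitseqs (bs : bitseq) : bs \in all_bitseqs (size bs).
Proof.
elim: bs => [|x bs IH] //=; rewrite mem_cat.
by case: x; rewrite map_f // orbT.
Qed.

Lemma size_all_bitseqs (k : nat) (bs : bitseq) : bs \in all_bitseqs k -> size bs = k.
Proof.
elim: k bs => [|k IH] bs /=; first by rewrite inE => /eqP ->.
by rewrite mem_cat => /orP[] /mapP[bs' /IH <- ->].
Qed.

(** Binomial theorem, as a sum over the sets of marked blocks. *)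
Lemma sum_all_bitseqs (R : comNzRingType) (k : nat) (y : R) :
  \sum_(bs <- all_bitseqs k) y ^+ count id bs = (1 + y) ^+ k.
Proof.
elim: k => [|k IH] /=; first by rewrite big_seq1.
rewrite big_cat !big_map exprS -IH mulrDl mul1r addrC; congr (_ + _).
by rewrite mulr_sumr; apply: eq_bigr => bs _; rewrite exprS.
Qed.

Lemma size_flatten_sum (T : Type) (R : nzSemiRingType) (ss : seq (seq T)) :
  (size (flatten ss))%:R = \sum_(s <- ss) (size s)%:R :> R.
Proof.
elim: ss => [|s ss IH]; first by rewrite big_nil.
by rewrite /= size_cat natrD IH big_cons.
Qed.

(** After [r] free digits come blocks of length [L], and [bs] marks those constrained to [W]. Free
    blocks are merged into the free prefix before separation is used, so the constant [C] is paid
    once at the start and once per marked block only. *)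
Lemma beta_val_blocks_list (R : realType) (b : R) (D : nat) (C : R) :
  0 < b -> 0 < C ->
  (forall r, exists2 s : seq R, (size s)%:R <= C * b ^+ r &
    forall e, (forall i, (e i <= D)%N) -> beta_val b r e \in s) ->
  forall (L : nat) (W : seq R) (bs : bitseq) (r : nat),
  exists2 s : seq R,
    (size s)%:R <= C * b ^+ r * (C * (size W)%:R) ^+ count id bs *
                   (b ^+ L) ^+ count negb bs &
    forall e, (forall i, (e i <= D)%N) ->
      (forall q, nth false bs q -> beta_val b L (fun i => e (r + q * L + i)%N) \in W) ->
      beta_val b (r + size bs * L) e \in s.
Proof.
move=> b0 C0 hC L W; elim=> [|x bs IH] r.
  have [s ss hs] := hC r; exists s; first by rewrite !expr0 !mulr1.
  by move=> e eD _; rewrite mul0n addn0; exact: hs.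
(* A marked block ends the free prefix: a value is a prefix value, plus an element of [W], plus a
   remainder whose own prefix starts at length 0 and brings one more [C]. *)
case: x => /=.
  have [s ss hs] := hC r; have [s' ss' hs'] := IH 0%N.
  exists [seq v + w | v <- s,
     w <- [seq b ^- r * w + b ^- (r + L) * u | w <- W, u <- s']].
    rewrite !size_allpairs add0n add1n !natrM.
    apply: (@le_trans _ _ (C * b ^+ r * ((size W)%:R * (C * b ^+ 0 *
        (C * (size W)%:R) ^+ count id bs * (b ^+ L) ^+ count negb bs)))).
      by rewrite ler_pM ?mulr_ge0 // ler_wpM2l.
    by rewrite le_eqVlt; apply/orP; left; apply/eqP; rewrite exprS expr0; ring.
  move=> e eD he.
  rewrite mulSn beta_valD; apply: allpairs_f; first exact: hs.
  have -> : b ^- r * beta_val b (L + size bs * L) (fun i => e (r + i)%N) =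
      b ^- r * beta_val b L (fun i => e (r + i)%N) +
      b ^- (r + L) * beta_val b (size bs * L) (fun i => e (r + L + i)%N).
    rewrite beta_valD mulrDr mulrA -invfM -exprD; congr (_ + _ * _).
    by apply: eq_beta_val => i _; rewrite addnA.
  apply: allpairs_f; first by have := he 0%N isT; rewrite mul0n addn0.
  have := hs' (fun i => e (r + L + i)%N) (fun i => eD _); rewrite add0n; apply => q hq.
  rewrite (@eq_beta_val _ b L _ (fun i => e (r + q.+1 * L + i)%N)); first exact: he.
  by move=> i _; congr e; lia.
(* An unmarked block just lengthens the prefix by [L], at the exact cost [b ^+ L]. *)
have [s ss hs] := IH (r + L)%N; exists s.
  apply: (le_trans ss); rewrite add0n add1n exprD exprS.
  by rewrite le_eqVlt; apply/orP; left; apply/eqP; ring.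
move=> e eD he; rewrite mulSn addnA; apply: hs => // q hq.
rewrite (@eq_beta_val _ b L _ (fun i => e (r + q.+1 * L + i)%N)); first exact: he.
by move=> i _; congr e; lia.
Qed.

(* A word with many blocks in W is counted with weight exp(2 #blocks) >= exp(k c);
   summing over the sets of blocks gives (1 + c/2)^k <= exp(k c / 2). *)
Lemma beta_val_frequent_list (R : realType) (b : R) (D : nat) : pisot b ->
  exists2 C : R, 0 < C & forall (L : nat) (W : seq R) (c : R) (a k : nat),
    C * (size W)%:R * b ^- L <= c ->
    exists2 s : seq R,
      (size s)%:R <= C * b ^+ (a + k * L) * expR (- (k%:R * c / 2)) &
      forall e (good : pred nat), (forall i, (e i <= D)%N) ->
        k%:R * c / 2 <= (count good (iota 0 k))%:R ->
        (forall q, (q < k)%N -> good q ->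
           beta_val b L (fun i => e (a + q * L + i)%N) \in W) ->
        beta_val b (a + k * L) e \in s.
Proof.
move=> hb; have b0 : 0 < b by case: hb => b1 _; lra.
have [C C0 hC] := beta_val_global_list D hb.
have e2 : 1 <= expR 2 :> R by rewrite -expR0 ler_expR.
(* The factor [2 * expR 2] turns the hypothesis into [expR 2 * x <= c / 2], as needed for the
   weighted count. *)
exists (C * (2 * expR 2)); first by rewrite mulr_gt0 //; lra.
move=> L W c a k hc.
set x := C * (size W)%:R * b ^- L.
have x0 : 0 <= x by rewrite !mulr_ge0 ?invr_ge0 ?exprn_ge0 // ltW.
have xc : expR 2 * x <= c / 2 by rewrite ler_pdivlMr // /x; apply: le_trans hc; lra.
have xE : C * (size W)%:R = x * b ^+ L by rewrite mulfVK // expf_neq0 // gt_eqF.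
clearbody x; have hB bs := beta_val_blocks_list b0 C0 hC L W bs a.
have /choice[F HF] : forall bs : bitseq, exists s : seq R,
   (size s)%:R <= C * b ^+ a * (C * (size W)%:R) ^+ count id bs *
                   (b ^+ L) ^+ count negb bs /\
    forall e, (forall i, (e i <= D)%N) ->
      (forall q, nth false bs q -> beta_val b L (fun i => e (a + q * L + i)%N) \in W) ->
      beta_val b (a + size bs * L) e \in s.
  by move=> bs; have [s ? ?] := hB bs; exists s.
exists (flatten [seq F bs | bs <- all_bitseqs k & k%:R * c / 2 <= (count id bs)%:R]).
  rewrite size_flatten_sum big_map big_filter.
  apply: (@le_trans _ _ (\sum_(bs <- all_bitseqs k)
      C * b ^+ (a + k * L) * expR (- (k%:R * c)) * (expR 2 * x) ^+ count id bs)).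
    rewrite big_mkcond big_seq [leRHS]big_seq; apply: ler_sum => bs bsk.
    case: ifP => [kc|_]; last first.
      have [C0' b0'] := (ltW C0, ltW b0).
      apply: mulr_ge0; last by rewrite exprn_ge0 // mulr_ge0 // expR_ge0.
      by apply: mulr_ge0; [apply: mulr_ge0 => //; exact: exprn_ge0|exact: expR_ge0].
    have [+ _] := HF bs => /le_trans; apply.
    have kE : k = (count id bs + count negb bs)%N.
      by rewrite -(size_all_bitseqs bsk) -(count_predC id).
    rewrite xE.
    have -> : C * b ^+ a * (x * b ^+ L) ^+ count id bs * (b ^+ L) ^+ count negb bs =
        C * b ^+ (a + k * L) * x ^+ count id bs.
      rewrite exprD mulnC exprM {1}kE exprD exprMn; ring.
    rewrite exprMn -!mulrA ler_wpM2l ?(ltW C0) // ler_wpM2l ?exprn_ge0 ?(ltW b0) //.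
    rewrite mulrA ler_peMl ?exprn_ge0 // expRN mulrC -expRM_natl.
    rewrite ler_pdivlMr ?expR_gt0 // mul1r ler_expR.
    by move: kc; rewrite ler_pdivrMr // mulr_natr -[_ *+ 2]mulr_natr mulr_natl mulr_natr.
  rewrite -mulr_sumr sum_all_bitseqs -mulrA [leRHS]mulrAC -!mulrA.
  rewrite ler_wpM2l ?(ltW C0) //; apply: (@le_trans _ _ (b ^+ (a + k * L) * expR (- (k%:R * c / 2)))).
    rewrite ler_wpM2l ?exprn_ge0 ?(ltW b0) // -ler_pdivlMl ?expR_gt0 // -expRN opprK -expRD.
    have -> : k%:R * c - k%:R * c / 2 = k%:R * (c / 2) by field.
    rewrite expRM_natl; apply: lerXn2r; rewrite ?nnegrE ?expR_ge0 //.
      by rewrite addr_ge0 // mulr_ge0 //; lra.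
    by apply: le_trans (expR_ge1Dx _); rewrite lerD2l.
  rewrite -[k%:R * c / 2]mulrA [_ * expR _]mulrC (mulrA 2) ler_peMl; [by []| |lra].
  by rewrite mulr_ge0 ?expR_ge0 // exprn_ge0 // ltW.
move=> e good eD kc hgood.
(* Exactly the good blocks are marked, so this pattern is among those retained. *)
pose bs := mkseq good k; have bsk : size bs = k by rewrite size_mkseq.
apply/flattenP; exists (F bs).
  apply/mapP; exists bs => //; rewrite mem_filter -{2}bsk mem_all_bitseqs andbT.
  by rewrite /bs /mkseq count_map.
have [_ hF] := HF bs; have := hF e eD; rewrite bsk; apply => q.
have [qk|kq] := ltnP q k; last by rewrite nth_default // bsk.
by rewrite nth_mkseq // => gq; exact: hgood.
Qed.

(** * Greedy expansions with erased digits *)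

Lemma unit_uniform (R : realType) : exists P : probability R R,
  P `[0%R, 1%R[%classic = 1%E /\ forall v h : R, 0 <= h -> (P `[v, (v + h)%R]%classic <= h%:E)%E.
Proof.
(* The pushforward along the identity carries the uniform law from [measurableTypeR R] to [R]. *)
pose idTR : measurableTypeR R -> R := idfun.
have mid : measurable_fun setT idTR by exact: measurable_id.
pose X : {mfun measurableTypeR R >-> R} := HB.pack idTR (isMeasurableFun.Build _ _ _ _ _ mid).
pose P : probability R R := distribution (uniform_prob (@ltr01 R)) X.
have PE (U : set R) : measurable U ->
    P U = lebesgue_measure (U `&` `[0, 1]%classic).
  move=> mU; rewrite /P /distribution /pushforward /= preimage_id /uniform_prob.
  rewrite integral_uniform_pdf (eq_integral (fun=> 1%E)); last first.
    move=> x; rewrite inE /= => -[_]; rewrite in_itv /= /uniform_pdf => ->.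
    by rewrite subr0 invr1.
  by rewrite integral_cst ?mul1e //; exact: measurableI.
exists P; split.
  rewrite PE // setIidl; last first.
    by move=> x /=; rewrite !in_itv /= => /andP[-> /ltW].
  by rewrite lebesgue_measure_itv /= lte_fin ltr01 sube0.
move=> v h h0; rewrite PE //.
apply: (@le_trans _ _ (lebesgue_measure `[v, (v + h)%R]%classic)).
  by apply: le_measure; rewrite ?inE //; exact: measurableI.
rewrite lebesgue_measure_itv /= lte_fin; case: ifP => _; last by rewrite lee_fin.
by rewrite -EFinB lee_fin addrAC subrr add0r.
Qed.

Lemma measure_intervals_le (R : realType) (P : probability R R) (s : seq R) (h : R) :
  0 <= h -> (forall v h : R, 0 <= h -> (P `[v, (v + h)%R]%classic <= h%:E)%E) ->
  (P (\bigcup_(v in [set` s]) `[v, (v + h)%R]%classic) <= ((size s)%:R * h)%:E)%E.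
Proof.
move=> h0 hP; rewrite bigcup_seq; elim: s => [|v s IH].
  by rewrite big_nil measure0 mul0r.
rewrite big_cons (le_trans (measureU2 _ _ _)) //.
  by apply: bigsetU_measurable => w _.
by rewrite /= -addn1 natrD mulrDl mul1r addrC EFinD leeD // hP.
Qed.

Lemma geometric_scale (R : realType) (b d : R) : 1 < b -> 0 < d -> d <= 1 ->
  exists N, b ^- N.+1 < d /\ d <= b ^- N.
Proof.
move=> b1 d0 d1; have b0 : 0 < b by lra.
have ex : exists n, b ^- n < d.
  have : (geometric 1 b^-1 x @[x --> \oo] --> (0:R))%classic.
    by apply: cvg_geometric; rewrite ger0_norm ?invr_ge0 ?(ltW b0) // invf_lt1.
  move/cvgrPdist_lt => /(_ _ d0)[n _ /(_ n (leqnn n))].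
  rewrite /= sub0r normrN mul1r ger0_norm ?exprn_ge0 ?invr_ge0 ?(ltW b0) //.
  by rewrite exprVn => ?; exists n.
(* The least [n] with [b ^- n < d] is positive because [d <= 1], and [N] is its predecessor. *)
have := ex_minnP ex; case=> -[|N]; first by rewrite expr0 invr1 ltNge d1.
move=> hN hmin; exists N; split => //; rewrite leNgt; apply/negP => /hmin.
by rewrite ltnn.
Qed.

(** The greedy digit as a natural number; for [x] in [[0,1)] the truncation agrees with the floor
    used in [Tbeta]. *)
Definition beta_digit (R : realType) (b x : R) (i : nat) : nat :=
  Num.truncn (b * iter i (Tbeta b) x).

Lemma Tbeta_itv (R : realType) (b x : R) : 0 <= Tbeta b x < 1.
Proof.
rewrite /Tbeta; have /andP[h1 h2] := floor_itv (b * x).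
by rewrite subr_ge0 h1 /= ltrBlDl -intrD1.
Qed.

Lemma Tbeta1_id (R : realType) (x : R) : 0 <= x < 1 -> Tbeta 1 x = x.
Proof.
by move=> h; rewrite /Tbeta mul1r (@floor_def _ _ 0) ?subr0 // add0r.
Qed.

Lemma iter_Tbeta_itv (R : realType) (b x : R) (i : nat) :
  0 <= x < 1 -> 0 <= iter i (Tbeta b) x < 1.
Proof. by case: i => // i _; exact: Tbeta_itv. Qed.

Lemma beta_digit_le (R : realType) (b x : R) (i : nat) :
  0 < b -> 0 <= x < 1 -> (beta_digit b x i <= Num.truncn b)%N.
Proof.
move=> b0 /(iter_Tbeta_itv b i) /andP[h1 h2]; apply: le_truncn.
by rewrite ler_piMr // ltW.
Qed.

Lemma beta_digit_iter (R : realType) (b x : R) (m i : nat) :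
  beta_digit b (iter m (Tbeta b) x) i = beta_digit b x (m + i).
Proof. by rewrite /beta_digit -iterD addnC. Qed.

Lemma beta_expansion (R : realType) (b x : R) (N : nat) : 0 < b -> 0 <= x < 1 ->
  x = beta_val b N (beta_digit b x) + b ^- N * iter N (Tbeta b) x.
Proof.
move=> b0 hx; elim: N => [|N IH]; first by rewrite /beta_val big_ord0 expr0 invr1 mul1r add0r.
rewrite {1}IH beta_valS -addrA; congr (_ + _) => /=; set y := iter N _ x.
have /andP[y0 y1] : 0 <= y < 1 by exact: iter_Tbeta_itv.
have -> : Tbeta b y = b * y - (beta_digit b x N)%:R.
  rewrite /Tbeta /beta_digit -/y truncn_floor mulr_ge0 ?(ltW b0) //.
  by rewrite natr_absz ger0_norm // floor_ge0 mulr_ge0 // ltW.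
rewrite exprS invfM; field.
by rewrite expf_neq0 gt_eqF.
Qed.

Lemma measurable_Tbeta (R : realType) (b : R) : measurable_fun [set: R] (Tbeta b).
Proof.
apply: measurable_funB; first exact: measurable_funM.
apply: (measurableT_comp (f := fun x : R => (Num.floor x)%:~R : R)); last exact: measurable_funM.
apply: nondecreasing_measurable => // x y xy; rewrite ler_int; exact: le_floor.
Qed.

Lemma measurable_iter_Tbeta (R : realType) (b : R) (i : nat) :
  measurable_fun [set: R] (iter i (Tbeta b)).
Proof.
elim: i => [|i IH]; first exact: measurable_id.
by apply: (measurableT_comp (f := Tbeta b)) => //; exact: measurable_Tbeta.
Qed.

Lemma measurable_beta_digit (R : realType) (b : R) (i : nat) :
  measurable_fun [set: R] (fun x => (beta_digit b x i)%:R : R).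
Proof.
apply: (measurableT_comp (f := fun x : R => (Num.truncn x)%:R : R)).
  apply: nondecreasing_measurable => // x y xy; rewrite ler_nat; exact: le_truncn.
by apply: measurable_funM => //; exact: measurable_iter_Tbeta.
Qed.

Definition mask_digits (S : pred nat) (e : nat -> nat) (i : nat) : nat :=
  if S i then 0%N else e i.

(* Precomposing with the fractional part [Tbeta 1] makes every digit bounded. *)
Definition masked_expansion (R : realType) (b : R) (S : pred nat) (u : R) : R :=
  limn (fun N => beta_val b N (mask_digits S (beta_digit b (Tbeta 1 u)))).

Lemma mask_digits_le (S : pred nat) (e : nat -> nat) (D i : nat) :
  (e i <= D)%N -> (mask_digits S e i <= D)%N.
Proof. by rewrite /mask_digits; case: ifP. Qed.

Lemma masked_expansion_cvg (R : realType) (b : R) (S : pred nat) (u : R) : 1 < b ->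
  beta_val b N (mask_digits S (beta_digit b (Tbeta 1 u))) @[N --> \oo] -->
    masked_expansion b S u.
Proof.
move=> b1; have b0 : 0 < b by lra.
apply: nondecreasing_is_cvgn; first by move=> m n; exact: beta_val_le.
exists ((Num.truncn b)%:R / (b - 1)) => _ [n _ <-].
have := @beta_val_tail R b (Num.truncn b) (mask_digits S (beta_digit b (Tbeta 1 u))) 0 n b1.
rewrite {2}/beta_val big_ord0 add0r expr0 invr1 mulr1; apply => // i.
by apply: mask_digits_le; exact: beta_digit_le (Tbeta_itv _ _).
Qed.

Lemma masked_expansion_itv (R : realType) (b : R) (S : pred nat) (u : R) (N : nat) :
  1 < b ->
  beta_val b N (mask_digits S (beta_digit b (Tbeta 1 u))) <= masked_expansion b S u <=
  beta_val b N (mask_digits S (beta_digit b (Tbeta 1 u))) + (Num.truncn b)%:R / (b - 1) * b ^- N.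
Proof.
move=> b1; set v := beta_val b N _; have b0 : 0 < b by lra.
have cv := @masked_expansion_cvg R b S u b1.
apply/andP; split.
  apply: nondecreasing_cvgn_le; first by move=> m n; exact: beta_val_le.
  by apply/cvg_ex; eexists; exact: cv.
apply: limr_le; first by apply/cvg_ex; eexists; exact: cv.
exists N => // n /= Nn; apply: beta_val_tail => // i.
by apply: mask_digits_le; exact: beta_digit_le (Tbeta_itv _ _).
Qed.

Lemma measurable_masked_expansion (R : realType) (b : R) (S : pred nat) : 1 < b ->
  measurable_fun [set: R] (masked_expansion b S).
Proof.
move=> b1; apply: (@measurable_fun_cvg _ _ _ _ (fun N u =>
    beta_val b N (mask_digits S (beta_digit b (Tbeta 1 u))))); last first.
  by move=> u _; exact: masked_expansion_cvg.
move=> N; apply: measurable_sum => i; apply: measurable_funM => //.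
rewrite /mask_digits; case: (S i) => //.
by apply: (measurableT_comp (measurable_beta_digit b i)); exact: measurable_Tbeta.
Qed.

(** At scale [b ^- N], separation leaves boundedly many kept values, and each choice of erased
    digits then confines [u] to an interval of length [b ^- N]. The hypothesis on [q] converts the
    number of such choices into a power of [b], which lowers the exponent by [q * eps]. *)
Lemma masked_expansion_frostman (R : realType) (b : R) (S : pred nat) (A eps : R) (q : nat)
    (P : probability R R) :
  pisot b -> (Num.truncn b).+1%:R <= b ^+ q ->
  0 <= A -> 0 <= eps -> q%:R * eps <= 1 ->
  (forall N, (count S (iota 0 N))%:R <= A + eps * N%:R) ->
  P `[0%R, 1%R[%classic = 1%E ->
  (forall v h : R, 0 <= h -> (P `[v, (v + h)%R]%classic <= h%:E)%E) ->
  exists2 C : R, 0 <= C & forall x d : R, 0 < d -> d <= 1 ->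
    (P (masked_expansion b S @^-1` `[(x - d)%R, (x + d)%R]) <=
       (C * d `^ (1 - q%:R * eps))%:E)%E.
Proof.
move=> hb Dq A0 eps0 qe cS P1 hP; have b1 : 1 < b by case: hb.
have b0 : 0 < b by lra.
set D := Num.truncn b in Dq *.
have [c c0 hc] := beta_val_local_list D hb.
set K : R := D%:R / (b - 1); have K0 : 0 <= K by rewrite divr_ge0 //; lra.
(* The window for the kept value has length [(2 + K) * b ^- N]: 2 from the interval of radius
   [d <= b ^- N], and [K] from the truncated tail. *)
set M : R := (2 + K) / c + 1; have M0 : 0 <= M by rewrite addr_ge0 // divr_ge0 //; lra.
set s := 1 - q%:R * eps; have s0 : 0 <= s by rewrite /s; lra.
(* The second factor pays for the additive [A] in the count of erased positions, the third for
   rounding [d] to a power of [b]. *)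
exists (M * b `^ (q%:R * A) * b `^ s); first by rewrite !mulr_ge0 ?powR_ge0.
move=> x d d0 d1; have [N [dN1 dN]] := geometric_scale b1 d0 d1.
have bN : 0 < b ^- N by rewrite invr_gt0 exprn_gt0.
have [|s1 ss1 hs1] := hc N (x - (1 + K) * b ^- N) ((2 + K) * b ^- N).
  by rewrite mulr_ge0 //; lra.
have [s2 ss2 hs2] := beta_val_supported_list b D S N.
pose Z := [seq v + w | v <- s1, w <- s2].
(* Points outside [[0,1)] form a null set and are split off, since the digits used are those of the
   fractional part of [u]. *)
have sub : masked_expansion b S @^-1` `[(x - d)%R, (x + d)%R] `<=`
    ~` `[0%R, 1%R[%classic `|` \bigcup_(v in [set` Z]) `[v, (v + b ^- N)%R]%classic.
  move=> u /=; rewrite in_itv /= => /andP[fu1 fu2].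
  have [u01|u01] := boolP (0 <= u < 1); last by left; rewrite in_itv /=; apply/negP.
  right; have := @masked_expansion_itv R b S u N b1; rewrite Tbeta1_id //.
  set v := beta_val b N _ => /andP[v1 v2].
  have eD i := @beta_digit_le R b u i b0 u01.
  exists (v + beta_val b N (fun i => if S i then beta_digit b u i else 0%N)).
    apply/allpairsP; exists (v, beta_val b N (fun i => if S i then beta_digit b u i else 0%N)).
    split => //=; last exact: hs2.
    apply: hs1 => [i|]; first exact: mask_digits_le.
    by apply/andP; split; rewrite -/v; move: v2; rewrite -/K; nra.
  (* Kept and erased digits add up to all greedy digits, so the sum is the truncated expansion of
     [u]. *)
  rewrite -beta_val_add (@eq_beta_val _ _ _ _ (beta_digit b u)); last first.
    by move=> i _; rewrite /mask_digits; case: (S i); rewrite ?addn0.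
  rewrite /= in_itv /= {2 3}(@beta_expansion R b u N) // lerDl lerD2l.
  have /andP[t0 t1] := @iter_Tbeta_itv R b u N u01.
  by rewrite mulr_ge0 ?(ltW bN) //= ler_piMr ?(ltW bN) // ltW.
have mI : measurable (masked_expansion b S @^-1` `[(x - d)%R, (x + d)%R]).
  by rewrite -[X in measurable X]setTI; exact: measurable_masked_expansion.
have mU : measurable (\bigcup_(v in [set` Z]) `[v, (v + b ^- N)%R]%classic).
  by rewrite bigcup_seq; apply: bigsetU_measurable.
apply: (@le_trans _ _ (P (~` `[0%R, 1%R[%classic `|`
    \bigcup_(v in [set` Z]) `[v, (v + b ^- N)%R]%classic))).
  by apply: le_measure; rewrite ?inE //; apply: measurableU => //; exact: measurableC.
apply: (le_trans (measureU2 _ _ _)) => //; first exact: measurableC.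
have PC0 : P (~` `[0%R, 1%R[%classic) = 0%E by rewrite probability_setC // P1 subee.
rewrite [X in (X + _)%E]PC0 add0e; apply: (le_trans (measure_intervals_le _ (ltW bN) hP)).
rewrite lee_fin size_allpairs ss2 natrM.
have ss : (size s1)%:R <= M.
  by apply: (le_trans ss1); rewrite -(mulrA (2 + K)) mulVf ?mulr1 // expf_neq0 // gt_eqF.
have sc : (D.+1 ^ count S (iota 0 N))%:R <= b `^ (q%:R * A) * b `^ (q%:R * eps * N%:R).
  rewrite natrX; apply: (@le_trans _ _ (b ^+ q ^+ count S (iota 0 N))).
    by rewrite lerXn2r ?nnegrE // exprn_ge0 // ltW.
  rewrite -exprM -powR_mulrn ?(ltW b0) // -powRD; last by rewrite (gt_eqF b0) implybT.
  by rewrite ler_powR ?(ltW b1) // natrM -mulrA -mulrDr ler_wpM2l.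
apply: (@le_trans _ _ (M * (b `^ (q%:R * A) * b `^ (q%:R * eps * N%:R)) * b ^- N)).
  by rewrite ler_wpM2r ?(ltW bN) // ler_pM.
rewrite -!mulrA ler_wpM2l // ler_wpM2l ?powR_ge0 //.
have bNE : b ^- N = b `^ (- N%:R) by rewrite powRN powR_mulrn // ltW.
have -> : b `^ (q%:R * (eps * N%:R)) * b ^- N = (b ^- N) `^ s.
  rewrite [in RHS]bNE -powRrM bNE -powRD; last by rewrite (gt_eqF b0) implybT.
  by congr (_ `^ _); rewrite /s; ring.
rewrite -powRM ?(ltW b0) ?(ltW d0) // ge0_ler_powR ?nnegrE ?(ltW bN) ?mulr_ge0 ?(ltW b0) ?(ltW d0) //.
move: dN1; rewrite exprS invfM => dN1.
by rewrite -ler_pdivrMl // ltW.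
Qed.

(** * Density of the erased positions *)

Definition dyadic_blocks (p : nat) : pred nat :=
  fun i => `[< exists j, (p * 2 ^ j <= i < p.+1 * 2 ^ j)%N >].

(** The runs starting below [p * 2 ^ J] have lengths [1, 2, ..., 2 ^ (J - 1)], which add up to less
    than [2 ^ J]. *)
Lemma count_dyadic_blocks_pow2 (p J : nat) : (0 < p)%N ->
  (count (dyadic_blocks p) (iota 0 (p * 2 ^ J)) <= 2 ^ J)%N.
Proof.
move=> p0; have pow j : (0 < 2 ^ j)%N by rewrite expn_gt0.
elim: J => [|J IH].
  rewrite expn0 muln1 (@eq_in_count _ _ pred0) ?count_pred0 // => i.
  rewrite mem_iota => /andP[_ ip]; apply/negbTE/asboolPn => -[j /andP[h _]].
  by have := pow j; nia.
(* The new range is one run of length [2 ^ J] followed by a gap that meets no run. *)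
have -> : iota 0 (p * 2 ^ J.+1) = iota 0 (p * 2 ^ J) ++ iota (p * 2 ^ J) (2 ^ J) ++
    iota (p.+1 * 2 ^ J) (p.-1 * 2 ^ J).
  rewrite mulSn [(2 ^ J + _)%N]addnC -iotaD -[X in iota X _]add0n -iotaD; congr (iota _ _).
  by case: p p0 {IH} => // p _; rewrite expnS /=; lia.
rewrite !count_cat (_ : count _ (iota (p.+1 * _) _) = 0%N).
  rewrite addn0 expnS mul2n -addnn leq_add //.
  by rewrite (leq_trans (count_size _ _)) // size_iota.
rewrite (@eq_in_count _ _ pred0) ?count_pred0 // => i.
rewrite mem_iota => /andP[i1 i2]; apply/negbTE/asboolPn => -[j /andP[h1 h2]].
have {}i2 : (i < p * 2 ^ J.+1)%N.
  by move: i2; case: p p0 {IH i1 h1 h2} => // p _; rewrite expnS /=; lia.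
have [jJ|Jj] := leqP j J.
  have : (2 ^ j <= 2 ^ J)%N by rewrite leq_exp2l.
  by nia.
have : (2 ^ J.+1 <= 2 ^ j)%N by rewrite leq_exp2l.
by nia.
Qed.

Lemma count_dyadic_blocks (p N : nat) : (0 < p)%N ->
  (count (dyadic_blocks p) (iota 0 N) * p <= p + 2 * N)%N.
Proof.
move=> p0; have ex : exists J, (N <= p * 2 ^ J)%N.
  by exists N; have := ltn_expl N (isT : (1 < 2)%N); nia.
(* Minimality of [J] gives [2 ^ J < 2 * N / p] when [J > 0]; the case [J = 0] accounts for the
   additive [p]. *)
have [J hJ hmin] := ex_minnP ex.
have cN : (count (dyadic_blocks p) (iota 0 N) <= 2 ^ J)%N.
  apply: leq_trans (count_dyadic_blocks_pow2 J p0).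
  by rewrite -(subnKC hJ) iotaD count_cat leq_addr.
case: J hJ hmin cN => [|J] hJ hmin cN; first by rewrite expn0 in cN; nia.
have : (p * 2 ^ J < N)%N by rewrite ltnNge; apply/negP => /hmin; rewrite ltnn.
by rewrite expnS in cN; nia.
Qed.

(** * Resonance *)

Lemma invariant_iter (R : realType) (b : R) (nu : probability R R) (I : set R) (m : nat) :
  Tinvariant b nu -> measurable I -> nu (iter m (Tbeta b) @^-1` I) = nu I.
Proof.
move=> inv; elim: m I => [|m IH] I mI //.
have mT : measurable (Tbeta b @^-1` I).
  by rewrite -[X in measurable X]setTI; exact: measurable_Tbeta.
by rewrite -(inv I mI) -(IH _ mT).
Qed.

(** By invariance the number of visits to [I] at the [k] times has mean [k * c]; it never exceeds
    [k], so it is at least half its mean with probability at least [c / 2]. *)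
Lemma invariant_frequency (R : realType) (b : R) (nu : probability R R) (I : set R)
    (c : R) (m : nat -> nat) (k : nat) :
  Tinvariant b nu -> measurable I -> nu I = c%:E -> (0 < k)%N ->
  measurable [set y : R | k%:R * c / 2 <=
      \sum_(q <- iota 0 k) \1_I (iter (m q) (Tbeta b) y)] /\
  ((c / 2)%:E <= nu [set y | (k%:R * c / 2 <=
      \sum_(q <- iota 0 k) \1_I (iter (m q) (Tbeta b) y))%R])%E.
Proof.
move=> inv mI nuI k0.
pose h (y : R) : R := \sum_(q <- iota 0 k) \1_I (iter (m q) (Tbeta b) y).
pose E := [set y : R | k%:R * c / 2 <= h y].
change (measurable E /\ ((c / 2)%:E <= nu E)%E).
have k0' : 0 < k%:R :> R by rewrite ltr0n.
have c0 : 0 <= c by rewrite -lee_fin -nuI.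
have mh1 q : measurable_fun [set: R] (fun y => \1_I (iter (m q) (Tbeta b) y) : R).
  apply: (measurableT_comp (f := (\1_I : R -> R))); first exact: measurable_indic.
  exact: measurable_iter_Tbeta.
have mh : measurable_fun [set: R] h by exact: measurable_sum.
have mE : measurable E.
  rewrite (_ : E = setT `&` h @^-1` `[k%:R * c / 2, +oo[%classic).
    by apply: mh => //; exact: measurable_itv.
  by rewrite setTI; apply/seteqP; split => y /=; rewrite in_itv /= andbT.
split => //.
have int_h : (\int[nu]_y (h y)%:E = (k%:R * c)%:E)%E.
  rewrite /h; under eq_integral do rewrite -sumEFin.
  rewrite ge0_integral_sum //=; last first.
    by move=> q; apply/measurable_EFinP; exact: mh1.
  rewrite (eq_bigr (fun=> c%:E)) => [|q _].
    by rewrite sumEFin big_const_seq count_predT size_iota iter_addr_0 mulr_natl.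
  rewrite -nuI -(invariant_iter (m q) inv mI) -[in RHS](setIT (_ @^-1` _)).
  rewrite -integral_indic //.
  by rewrite -[X in measurable X]setTI; exact: measurable_iter_Tbeta.
have h_le y : h y <= k%:R * \1_E y + k%:R * c / 2.
  have kc0 : 0 <= k%:R * c / 2 by rewrite !mulr_ge0.
  rewrite indicE; have [yE|] := boolP (y \in E).
    rewrite mulr1 (@le_trans _ _ k%:R) ?lerDl //.
    rewrite /h (@le_trans _ _ (\sum_(q <- iota 0 k) 1)) //.
      by apply: ler_sum => q _; rewrite indicE lern1 leq_b1.
    by rewrite big_const_seq count_predT size_iota iter_addr_0.
  by rewrite notin_setE /E /= => /negP; rewrite -ltNge mulr0 add0r => /ltW.
have : ((k%:R * c)%:E <= k%:R%:E * nu E + (k%:R * c / 2)%:E)%E.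
  rewrite -int_h.
  apply: (@le_trans _ _ (\int[nu]_y (k%:R%:E * (\1_E y)%:E + (k%:R * c / 2)%:E))%E).
    apply: ge0_le_integral => //.
    - by move=> y _; rewrite lee_fin; apply: sumr_ge0.
    - exact/measurable_EFinP.
    - apply: emeasurable_funD => //; apply: emeasurable_funM => //.
      by apply/measurable_EFinP; exact: measurable_indic.
    by move=> y _; rewrite -EFinM -EFinD lee_fin.
  have mE' : measurable_fun [set: R] (fun y => (\1_E y)%:E : \bar R).
    by apply/measurable_EFinP; exact: measurable_indic.
  have kE y : (0 <= k%:R%:E * (\1_E y)%:E :> \bar R)%E by rewrite mule_ge0 ?lee_fin.
  have kc : (0 <= (k%:R * c / 2)%:E)%E by rewrite lee_fin !mulr_ge0.
  rewrite ge0_integralD //; last exact: emeasurable_funM.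
  by rewrite ge0_integralZl // integral_indic // setIT integral_cst // [X in (_ + _ * X)%E]probability_setT mule1 lexx .
have Efin : nu E \is a fin_num by exact: fin_num_measure.
rewrite -(fineK Efin) -EFinM -EFinD !lee_fin => hk.
by rewrite -(ler_pM2l k0'); lra.
Qed.

(** Level [j] covers the interval by [K * 2 ^ j + 1] dyadic intervals, whose cost at exponent
    [1 + e] decays like [2 ^ (- e j)]. *)
Lemma dim_meas_le1 (R : realType) (mu : {measure set R -> \bar R}) (K : nat) :
  (0 < mu `[0%R, K%:R%R]%classic)%E -> (dim_meas mu <= 1%:E)%E.
Proof.
move=> muK; apply/lee_addgt0Pr => e e0; rewrite -EFinD.
have h2 : 0 < 2^-1 :> R by lra.
(* This ratio dominates both the diameters and the costs. *)
pose q : R := Num.max 2^-1 (2^-1 `^ e).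
have q1 : q < 1.
  rewrite gt_max; apply/andP; split; first lra.
  have l2 : ln 2^-1 < 0 :> R by rewrite ln_lt0 // h2; lra.
  by rewrite /powR gt_eqF // -[ltRHS]expR0 ltr_expR pmulr_rlt0.
have q0 : 0 < q by rewrite lt_max h2.
apply: (dim_meas_le _ (measurable_itv `[0, K%:R]) muK); first lra.
apply: (@hausdorff_measure_limsup0 _ _ _ (K%:R + 1) q (fun j => 2^-1 ^+ j)
  (fun j => [seq i%:R * 2^-1 ^+ j | i <- iota 0 (K * 2 ^ j).+1])); rewrite ?q0 ?q1 //.
- lra.
- move=> j /=; apply: (@le_trans _ _ (q ^+ j)).
    by apply: lerXn2r; rewrite ?nnegrE ?(ltW h2) ?(ltW q0) // le_max lexx.
  by rewrite ler_peMl ?exprn_ge0 ?(ltW q0) // lerDr.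
- move=> j /=; rewrite size_map size_iota powRD; last by rewrite expf_neq0 ?implybT // gt_eqF.
  rewrite powRr1 ?exprn_ge0 ?(ltW h2) // mulrA.
  apply: ler_pM; rewrite ?powR_ge0 // ?mulr_ge0 ?exprn_ge0 ?(ltW h2) //.
    rewrite -addn1 natrD natrM natrX mulrDl -mulrA -exprMn divff // expr1n mulr1 mul1r.
    by rewrite lerD2l exprn_ile1 ?(ltW h2) //; lra.
  have -> : (2^-1 ^+ j) `^ e = (2^-1 `^ e) ^+ j.
    by rewrite -(powR_mulrn j (ltW h2)) -powRrM mulrC powRrM powR_mulrn // powR_ge0.
  by apply: lerXn2r; rewrite ?nnegrE ?powR_ge0 ?(ltW q0) // le_max lexx orbT.
move=> J x; rewrite [X in X -> _]/= in_itv => /andP[x0 xK]; exists J; first exact: leqnn.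
have x2 : 0 <= x * 2 ^+ J by rewrite mulr_ge0 // exprn_ge0.
have p2 : 0 < 2 ^+ J :> R by rewrite exprn_gt0.
have /andP[t1 t2] := truncn_itv x2.
exists ((Num.truncn (x * 2 ^+ J))%:R * 2^-1 ^+ J).
  apply: (map_f (fun i : nat => i%:R * 2^-1 ^+ J : R)).
  rewrite mem_iota leq0n andTb add0n ltnS -(ler_nat R) (le_trans t1) // natrM natrX.
  by rewrite ler_wpM2r // ltW.
rewrite /= in_itv /= exprVn ler_pdivrMr // t1 /=.
by rewrite -[X in _ + X]mul1r -mulrDl ler_pdivlMr // natr1 ltW.
Qed.

(** [Tbeta b] takes all its values in [[0,1)], so the preimage of that interval is the whole
    line. *)
Lemma invariant_unit_interval (R : realType) (b : R) (nu : probability R R) :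
  Tinvariant b nu -> nu `[0%R, 1%R[%classic = 1%E.
Proof.
move=> inv; have mU : measurable (`[0%R, 1%R[%classic : set R) by [].
have := inv _ mU; rewrite (_ : _ @^-1` _ = setT) ?probability_setT //.
apply/seteqP; split => // x _ /=; rewrite in_itv /=; exact: Tbeta_itv.
Qed.

(* As nu is not Frostman of exponent 1, it charges some interval far more than its
   length. *)
Lemma exists_heavy_words (R : realType) (b C : R) (nu : probability R R) :
  pisot b -> 0 < C -> (dim_meas nu < 1)%E ->
  exists (L : nat) (W : seq R) (I : set R) (c : R),
  [/\ (0 < L)%N, measurable I, nu I = c%:E, 0 < c &
    C * (size W)%:R * b ^- L <= c /\
    forall y, I y -> 0 <= y < 1 -> beta_val b L (beta_digit b y) \in W].
Proof.
move=> hb C0 dim1; have b1 : 1 < b by case: hb.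
have b0 : 0 < b by lra.
have [c1 c10 hc1] := beta_val_local_list (Num.truncn b) hb.
pose K := 3 / c1 + 1; have K0 : 0 < K by rewrite ltr_wpDl // divr_ge0 // ltW.
(* The first summand yields the bound on [C * size W * b ^- L]; the second rules out [L = 0],
   because [nu I <= 1]. *)
pose Cs := b * (C * K) + b; have Cs0 : 0 <= Cs by rewrite addr_ge0 // ?mulr_ge0 ?ltW.
have [x [d [d0 d1 hd]]] : exists x d : R, [/\ 0 < d, d <= 1 &
    ((Cs * d)%:E < nu `[(x - d)%R, (x + d)%R]%classic)%E].
  apply: contrapT => hn; have : (1%:E <= dim_meas nu)%E; last by rewrite leNgt dim1.
  apply: (@frostman_dim_meas _ nu Cs 1 Cs0) => x d d0 d1.
  rewrite powRr1 ?(ltW d0) // leNgt; apply/negP => h; apply: hn.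
  by exists x, d.
set I := `[(x - d)%R, (x + d)%R]%classic in hd.
have mI : measurable I by exact: measurable_itv.
have [c nuc] : exists c, nu I = c%:E.
  by exists (fine (nu I)); rewrite fineK //; exact: fin_num_measure.
rewrite nuc lte_fin in hd.
have c1' : c <= 1 by rewrite -lee_fin -nuc; exact: probability_le1.
have [L [dL1 dL]] := geometric_scale b1 d0 d1.
have bL : 0 < b ^- L by rewrite invr_gt0 exprn_gt0.
have bLd : b ^- L < b * d.
  by move: dL1; rewrite exprS invfM mulrC ltr_pdivrMr // mulrC.
(* The window of length [3 * b ^- L] consists of [I], of length at most [2 * b ^- L], and a margin
   [b ^- L] for the greedy remainder. *)
have [|W sW hW] := hc1 L (x - 2 * b ^- L) (3 * b ^- L).
  by rewrite mulr_ge0 // ltW.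
have sWK : (size W)%:R <= K.
  by apply: (le_trans sW); rewrite -(mulrA 3) mulVf ?mulr1 // expf_neq0 // gt_eqF.
have CKb : 0 <= C * K by rewrite mulr_ge0 ?ltW.
exists L, W, I, c; split => //.
- rewrite lt0n; apply/eqP => L0; move: bLd hd; rewrite L0 expr0 invr1 => bd.
  apply/negP; rewrite -leNgt (le_trans c1') // (le_trans (ltW bd)) //.
  by rewrite ler_wpM2r ?(ltW d0) // lerDr mulr_ge0 // ltW.
- by apply: le_lt_trans hd; rewrite mulr_ge0 // ltW.
split.
  apply: le_trans (ltW hd); apply: (@le_trans _ _ (C * K * (b * d))).
    apply: ler_pM; rewrite ?mulr_ge0 ?(ltW C0) ?(ltW bL) ?(ltW bLd) //.
    by rewrite ler_wpM2l // ltW.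
  by rewrite /Cs mulrDl mulrA [C * K * b]mulrC lerDl mulr_ge0 ?ltW.
move=> y; rewrite /I /= in_itv /= => /andP[y1 y2] y01.
apply: hW => [i|]; first exact: beta_digit_le.
have yE := beta_expansion L b0 y01; have /andP[t0 t1] := iter_Tbeta_itv b L y01.
have tb : 0 <= b ^- L * iter L (Tbeta b) y <= b ^- L.
  by rewrite mulr_ge0 ?(ltW bL) //= ler_piMr ?(ltW bL) // ltW.
by move: tb => /andP[tb1 tb2]; apply/andP; split; lra.
Qed.

(** The limsup is the decreasing limit of the tail unions, each of measure at least [a]. *)
Lemma measure_lim_sup_set_ge (R : realType) (nu : probability R R)
    (E : nat -> set R) (a : \bar R) :
  (forall j, measurable (E j)) -> (forall j, (a <= nu (E j))%E) ->
  (a <= nu (lim_sup_set E))%E.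
Proof.
move=> mE aE.
have cv : nu (\bigcup_(k >= n) E k) @[n --> \oo] --> nu (lim_sup_set E).
  apply: lim_sup_set_cvg => //; rewrite -ge0_fin_numE ?measure_ge0 //.
  by apply: fin_num_measure; exact: bigcup_measurable.
rewrite -(cvg_lim _ cv) //; apply: lime_ge; first by apply/cvg_ex; eexists; exact: cv.
apply: nearW => n; apply: (le_trans (aE n)); apply: le_measure; rewrite ?inE //.
  by apply: bigcup_measurable => k _.
by move=> y Ey; exists n => //=.
Qed.

(** The bound holds for every [u], so it survives integration against [P]; the integrand is
    measurable as the measure of the sections of a Borel set of the plane. *)
Lemma convolution_distribution_ge (R : realType) (P nu : probability R R)
    (X : {mfun R >-> R}) (A : set R) (a : \bar R) :
  (0 <= a)%E -> measurable A -> (forall u, (a <= nu [set y | A (X u + y)%R])%E) ->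
  (a <= convolution (distribution P X) nu A)%E.
Proof.
move=> a0 mA hA; rewrite /convolution.
pose B : set (R * R) := (fun z : R * R => z.1 + z.2) @^-1` A.
have mB : measurable B.
  have madd : measurable_fun [set: R * R] (fun z : R * R => z.1 + z.2).
    by apply: measurable_funD; [exact: measurable_fst|exact: measurable_snd].
  by rewrite /B -[X in measurable X]setTI; exact: madd.
have gE : (fun x : R => nu [set y | A (x + y)]) = nu \o xsection B.
  apply/funext => x /=; congr (nu _); apply/seteqP; split => y.
    by move=> Axy; apply/xsectionP.
  by move/xsectionP.
have mg : measurable_fun [set: R] (fun x : R => nu [set y | A (x + y)]).
  by rewrite gE; exact: measurable_fun_xsection.
rewrite ge0_integral_pushforward // preimage_setT /=.
apply: (@le_trans _ _ (\int[P]_u a)%E).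
  by rewrite integral_cst // [X in (_ * X)%E]probability_setT mule1.
apply: ge0_le_integral => //.
by apply: (measurableT_comp mg); exact: measurable_funP.
Qed.

Lemma dim_convolution_lt1 (R : realType) (b : R) (p : nat) (P nu : probability R R)
    (X : {mfun R >-> R}) :
  pisot b -> (0 < p)%N -> X =1 masked_expansion b (dyadic_blocks p) ->
  Tinvariant b nu -> (dim_meas nu < 1)%E ->
  (dim_meas (convolution (distribution P X) nu) < 1)%E.
Proof.
move=> hb p0 XE inv dim1; have b1 : 1 < b by case: hb.
have b0 : 0 < b by lra.
set D := Num.truncn b; set S := dyadic_blocks p.
(* Digits of [x] and of [y] are added without carries, hence the bound [D + D]. *)
have [C C0 hC] := beta_val_frequent_list (D + D) hb.
have [L [W [I [c [L0 mI nuI c0 [hW IW]]]]]] := exists_heavy_words hb C0 dim1.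
have c1 : c <= 1 by rewrite -lee_fin -nuI; exact: probability_le1.
(* [a j] starts a run of erased positions, [k j] blocks of length [L] fit into it, and [N j] is
   their end. The shift by [L] ensures [2 ^ j <= k j]. *)
pose a j := (p * 2 ^ (j + L))%N; pose k j := (2 ^ (j + L) %/ L)%N.
pose N j := (a j + k j * L)%N.
have k2 j : (2 ^ j <= k j)%N.
  rewrite leq_divRL // expnD leq_mul2l; apply/orP; right.
  exact/ltnW/ltn_expl.
have kj j : (j <= k j)%N by apply: leq_trans (k2 j); exact/ltnW/ltn_expl.
have k0 j : (0 < k j)%N by apply: leq_trans (k2 j); rewrite expn_gt0.
have aj j : (j <= a j)%N.
  apply: (@leq_trans (2 ^ (j + L))); last by rewrite leq_pmull.
  by apply: leq_trans (leq_addr L j) _; exact/ltnW/ltn_expl.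
have kL j : (k j * L <= 2 ^ (j + L))%N by exact: leq_divM.
(* As [N j] is at most proportional to [k j], a saving exponential in [k j] is a saving by a power
   of [b ^- N j]. *)
have NkL j : (N j <= 2 * p.+1 * L * k j)%N.
  have := ltn_ceil (2 ^ (j + L)) L0; rewrite -/(k j) => h1.
  have z2 : (2 ^ (j + L) <= 2 * (k j * L))%N by have := k0 j; nia.
  have : (p.+1 * 2 ^ (j + L) <= p.+1 * (2 * (k j * L)))%N by rewrite leq_mul2l z2 orbT.
  by have := kL j; rewrite /N /a; nia.
have blockS j q i : (q < k j)%N -> (i < L)%N -> S (a j + q * L + i)%N.
  move=> qk iL; apply/asboolP; exists (j + L)%N; have := kL j.
  by rewrite /a; set z := (2 ^ _)%N; nia.
set K : R := D%:R / (b - 1); have K0 : 0 <= K by rewrite divr_ge0 //; lra.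
(* [K] bounds the tail of [x] and 1 the greedy remainder of [y]. *)
pose r j := (K + 1) * b ^- N j.
have r0 j : 0 <= r j by rewrite mulr_ge0 ?invr_ge0 ?exprn_ge0 ?(ltW b0) // addr_ge0.
have /choice[s hs] : forall j, exists s : seq R,
    (size s)%:R <= C * b ^+ N j * expR (- ((k j)%:R * c / 2)) /\
    forall e (good : pred nat), (forall i, (e i <= D + D)%N) ->
        (k j)%:R * c / 2 <= (count good (iota 0 (k j)))%:R ->
        (forall q, (q < k j)%N -> good q ->
           beta_val b L (fun i => e (a j + q * L + i)%N) \in W) ->
        beta_val b (N j) e \in s.
  by move=> j; have [s ? ?] := hC L W c (a j) (k j) hW; exists s.
pose F j := \bigcup_(v in [set` s j]) `[v, v + r j]%classic.
have mF j : measurable (F j).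
  by rewrite /F bigcup_seq; apply: bigsetU_measurable => v _; exact: measurable_itv.
pose E j : set R := `[0%R, 1%R[%classic `&` [set y : R | (k j)%:R * c / 2 <=
  \sum_(q <- iota 0 (k j)) \1_I (iter (a j + q * L) (Tbeta b) y)].
have EF (u y : R) j : E j y -> F j (X u + y).
  rewrite /E /= in_itv /= => -[y01 hy].
  pose d1 := mask_digits S (beta_digit b (Tbeta 1 u)); pose d2 := beta_digit b y.
  have d1D i : (d1 i <= D)%N by apply: mask_digits_le; exact: beta_digit_le (Tbeta_itv _ _).
  have d2D i : (d2 i <= D)%N by exact: beta_digit_le.
  exists (beta_val b (N j) (fun i => d1 i + d2 i)%N).
    have [_ hsj] := hs j.
    apply: (hsj _ (fun q => iter (a j + q * L) (Tbeta b) y \in I)).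
    - by move=> i; exact: leq_add.
    - apply: (le_trans hy); rewrite -sum1_count natr_sum [leRHS]big_mkcond.
      by apply: ler_sum => q _; rewrite indicE; case: (_ \in I).
    move=> q qk /set_mem /IW; rewrite iter_Tbeta_itv // => /(_ isT).
    (* Inside a block the digits of [x] are erased, so the digit sums are the digits of the iterate
       of [y], which lies in [I]. *)
    rewrite (@eq_beta_val _ _ _ _ (fun i => d1 (a j + q * L + i) + d2 (a j + q * L + i))%N) //.
    by move=> i iL; rewrite beta_digit_iter /d1 /mask_digits blockS.
  rewrite beta_val_add /= in_itv /= XE.
  have := @masked_expansion_itv R b S u (N j) b1; rewrite -/d1 -/D -/K => /andP[f1 f2].
  have yE := beta_expansion (N j) b0 y01; have /andP[t0 t1] := iter_Tbeta_itv b (N j) y01.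
  have bN : 0 < b ^- N j by rewrite invr_gt0 exprn_gt0.
  have tb1 : 0 <= b ^- N j * iter (N j) (Tbeta b) y by rewrite mulr_ge0 // ltW.
  have tb2 : b ^- N j * iter (N j) (Tbeta b) y <= b ^- N j.
    by rewrite ler_piMr // ltW.
  move: yE f1 f2 tb1 tb2; rewrite /r mulrDl mul1r -/d2.
  set t := b ^- N j * iter _ _ _; move: (masked_expansion _ _ _) => X1 yE f1 f2 tb1 tb2.
  by apply/andP; split; lra.
have hE j : measurable (E j) /\ ((c / 2)%:E <= nu (E j))%E.
  have [mE' hE'] := @invariant_frequency R b nu I c (fun q => a j + q * L)%N (k j) inv mI nuI (k0 j).
  split; first exact: measurableI.
  have nuC0 : nu (~` `[0%R, 1%R[%classic) = 0%E.
    by rewrite probability_setC // (invariant_unit_interval inv) subee.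
  apply: (le_trans hE'); apply: (@le_trans _ _ (nu (E j `|` ~` `[0%R, 1%R[%classic))).
    apply: le_measure; rewrite ?inE //.
      by apply: measurableU; [exact: measurableI|exact: measurableC].
    move=> y hy; have [yU|yU] := pselect (`[0%R, 1%R[%classic y); last by right.
    by left; split.
  apply: (le_trans (measureU2 _ _ _)); [exact: measurableI|exact: measurableC|].
  by rewrite [X in (_ + X)%E]nuC0 adde0.
have mA : measurable (lim_sup_set F).
  by apply: bigcapT_measurable => n; apply: bigcup_measurable.
have convA : (0 < convolution (distribution P X) nu (lim_sup_set F))%E.
  apply: (@lt_le_trans _ _ (c / 2)%:E); first by rewrite lte_fin divr_gt0.
  apply: convolution_distribution_ge => //; first by rewrite lee_fin divr_ge0 // ltW.
  move=> u; apply: (@le_trans _ _ (nu (lim_sup_set E))).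
    by apply: measure_lim_sup_set_ge => j; have [] := hE j.
  have mlE : measurable (lim_sup_set E).
    by apply: bigcapT_measurable => n; apply: bigcup_measurable => j _; have [] := hE j.
  apply: le_measure; rewrite ?inE //.
    rewrite (_ : [set y | _] = setT `&` (fun y => X u + y) @^-1` lim_sup_set F); last first.
      by rewrite setTI.
    by apply: measurable_funD => //; exact: measurable_cst.
  by move=> y hy n _; have [j nj Ej] := hy n Logic.I; exists j => //; exact: EF.
(* Together with [N j <= 2 * p.+1 * L * k j] this gives [th * N j * ln b <= k j * c / 4], half of
   the available exponent; the minimum keeps [1 - th] nonnegative. *)
pose th := Num.min 1 (c / (8 * p.+1%:R * L%:R * ln b)).
have lnb : 0 < ln b by rewrite ln_gt0.
have pL : 0 < 8 * p.+1%:R * L%:R * ln b by rewrite !mulr_gt0 // ltr0n.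
have th0 : 0 < th by rewrite lt_min ltr01 divr_gt0.
have th1 : th <= 1 by rewrite ge_min lexx.
apply: (@le_lt_trans _ _ (1 - th)%:E); last by rewrite lte_fin gtrBl.
apply: (dim_meas_le _ mA convA); first by rewrite subr_ge0.
(* The first term controls the costs of the covers, the second their diameters. *)
pose q : R := Num.max (expR (- (c / 4))) b^-1.
have q0 : 0 < q by rewrite lt_max expR_gt0.
have q1 : q < 1.
  rewrite gt_max invf_lt1 // b1 andbT -[ltRHS]expR0 ltr_expR oppr_lt0 divr_gt0 //.
have K1 : 1 <= K + 1 by rewrite lerDr.
apply: (@hausdorff_measure_limsup0 _ _ _ ((C + 1) * (K + 1)) q r s) => //.
- by rewrite subr_ge0.
- by rewrite q0.
- by rewrite mulr_ge0 // addr_ge0 // ltW.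
- move=> j; rewrite /r [(C + 1) * _]mulrC -mulrA ler_wpM2l ?addr_ge0 //.
  apply: (@le_trans _ _ (b^-1 ^+ j)).
    rewrite exprVn lef_pV2 ?posrE ?exprn_gt0 // ler_weXn2l ?(ltW b1) //.
    exact: leq_trans (aj j) (leq_addr _ _).
  apply: (@le_trans _ _ (q ^+ j)).
    by apply: lerXn2r; rewrite ?nnegrE ?invr_ge0 ?(ltW b0) ?(ltW q0) // le_max lexx orbT.
  by rewrite ler_peMl ?exprn_ge0 ?(ltW q0) // lerDr ltW.
- move=> j; have [sj _] := hs j.
  have bNth : (b ^- N j) `^ (1 - th) * b ^+ N j <= expR ((k j)%:R * c / 4).
    have -> : (b ^- N j) `^ (1 - th) * b ^+ N j = expR (th * (N j)%:R * ln b).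
      have bNE : b ^+ N j = expR ((N j)%:R * ln b) by rewrite expRM_natl lnK.
      rewrite /powR gt_eqF ?invr_gt0 ?exprn_gt0 // lnV ?posrE ?exprn_gt0 //.
      by rewrite bNE expRK -expRD; congr expR; ring.
    rewrite ler_expR; apply: (@le_trans _ _ (th * (2 * p.+1 * L * k j)%:R * ln b)).
      by rewrite ler_wpM2r ?(ltW lnb) // ler_wpM2l ?(ltW th0) // ler_nat.
    have : th <= c / (8 * p.+1%:R * L%:R * ln b) by rewrite ge_min lexx orbT.
    rewrite ler_pdivlMr // !natrM => h.
    rewrite (_ : _ * ln b = (k j)%:R * (th * (8 * p.+1%:R * L%:R * ln b)) / 4); last by field.
    by rewrite ler_pM2r ?invr_gt0 // ler_wpM2l.
  have rth : r j `^ (1 - th) <= (K + 1) * (b ^- N j) `^ (1 - th).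
    rewrite /r powRM ?addr_ge0 ?invr_ge0 ?exprn_ge0 ?(ltW b0) //.
    by rewrite ler_wpM2r ?powR_ge0 // ler1_powR // gerBl ltW.
  apply: (@le_trans _ _ (C * b ^+ N j * expR (- ((k j)%:R * c / 2)) *
      ((K + 1) * (b ^- N j) `^ (1 - th)))).
    by apply: ler_pM; rewrite ?powR_ge0.
  have -> : C * b ^+ N j * expR (- ((k j)%:R * c / 2)) * ((K + 1) * (b ^- N j) `^ (1 - th)) =
      C * (K + 1) * (expR (- ((k j)%:R * c / 2)) * ((b ^- N j) `^ (1 - th) * b ^+ N j)).
    by ring.
  apply: ler_pM; rewrite ?mulr_ge0 ?expR_ge0 ?powR_ge0 ?exprn_ge0 ?(ltW b0) ?(ltW C0) ?addr_ge0 //.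
    by rewrite ler_wpM2r ?addr_ge0 // lerDl.
  apply: (@le_trans _ _ (expR (- ((k j)%:R * c / 2)) * expR ((k j)%:R * c / 4))).
    by rewrite ler_wpM2l ?expR_ge0.
  rewrite -expRD; apply: (@le_trans _ _ (expR (- (c / 4)) ^+ j)).
    rewrite -expRM_natl ler_expR.
    have : j%:R * c <= (k j)%:R * c by rewrite ler_wpM2r ?(ltW c0) // ler_nat.
    by lra.
  by apply: lerXn2r; rewrite ?nnegrE ?expR_ge0 ?(ltW q0) // le_max lexx.
by move=> J y /(_ J Logic.I) [j /= Jj Fj]; exists j.
Qed.

(** * Dimensions of the measures and resonance *)

Lemma dim_masked_expansion_ge (R : realType) (b : R) (q p : nat) (P : probability R R)
    (X : {mfun R >-> R}) :
  pisot b -> (Num.truncn b).+1%:R <= b ^+ q -> (0 < p)%N ->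
  P `[0%R, 1%R[%classic = 1%E ->
  (forall v h : R, 0 <= h -> (P `[v, (v + h)%R]%classic <= h%:E)%E) ->
  X =1 masked_expansion b (dyadic_blocks p) ->
  ((1 - q%:R * (2 / p%:R))%:E <= dim_meas (distribution P X))%E.
Proof.
move=> hb hq p0 P1 hP XE; have p0' : 0 < p%:R :> R by rewrite ltr0n.
(* For small [p] the lower bound is negative and holds trivially. *)
have [qp|qp] := leP (q%:R * (2 / p%:R) : R) 1; last first.
  by apply: le_trans (dim_meas_ge0 _); rewrite lee_fin subr_le0 ltW.
have cS N : (count (dyadic_blocks p) (iota 0 N))%:R <= 1 + 2 / p%:R * N%:R :> R.
  rewrite -(ler_pM2r p0') mulrDl mul1r mulrAC divfK ?gt_eqF //.
  by rewrite -!natrM -natrD ler_nat; exact: count_dyadic_blocks.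
have e0 : 0 <= 2 / p%:R :> R by rewrite divr_ge0.
have [C C0 hC] := masked_expansion_frostman hb hq ler01 e0 qp cS P1 hP.
apply: (@frostman_dim_meas _ (distribution P X) C _ C0) => x d d0 d1.
by move: (hC x d d0 d1); rewrite -(funext XE).
Qed.

Lemma dim_masked_expansion_le (R : realType) (b : R) (S : pred nat) (P : probability R R)
    (X : {mfun R >-> R}) :
  1 < b -> X =1 masked_expansion b S -> (dim_meas (distribution P X) <= 1)%E.
Proof.
move=> b1 XE; set K := (Num.truncn b)%:R / (b - 1) : R.
have K0 : 0 <= K by rewrite divr_ge0 //; lra.
apply: (@dim_meas_le1 _ (distribution P X) (Num.truncn K).+1).
have XK : X @^-1` `[0%R, (Num.truncn K).+1%:R] = setT.
  apply/seteqP; split => // u _ /=; rewrite in_itv /= XE.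
  have := @masked_expansion_itv R b S u 0 b1.
  rewrite /beta_val big_ord0 add0r expr0 invr1 mulr1 => /andP[-> /= /le_trans]; apply.
  by have /andP[_ /ltW] := truncn_itv K0.
change (0 < P (X @^-1` `[0%R, (Num.truncn K).+1%:R]))%E.
by rewrite XK probability_setT.
Qed.

Theorem theorem5p5 (R : realType) (b : R) :
  pisot b ->
  exists tau : nat -> probability R R,
    (fun n => dim_meas (tau n)) @ \oo --> 1%E /\
    forall nu : probability R R,
      nu `[(0:R), 1]%classic = 1%E ->
      Tinvariant b nu ->
      (0 < dim_meas nu)%E -> (dim_meas nu < 1)%E ->
      \forall n \near \oo, resonate (tau n) nu.
Proof.
move=> hb; have b1 : 1 < b by case: hb.
have [P [P1 hP]] := unit_uniform R.
(* Some power of [b] exceeds the number of digits; it comes from the scale of its inverse. *)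
have [q hq] : exists q, (Num.truncn b).+1%:R <= b ^+ q.
  have d0 : 0 < (Num.truncn b).+1%:R^-1 :> R by rewrite invr_gt0.
  have [|N [hN _]] := geometric_scale b1 d0; first by rewrite invf_le1 // ler1n.
  by exists N.+1; move: hN; rewrite ltf_pV2 ?posrE ?exprn_gt0 //; [move/ltW|lra].
pose f n := masked_expansion b (dyadic_blocks n.+1).
have mf n : measurable_fun [set: R] (f n) by exact: measurable_masked_expansion.
pose X n : {mfun R >-> R} := HB.pack (f n) (isMeasurableFun.Build _ _ _ _ (f n) (mf n)).
have XE n : X n =1 masked_expansion b (dyadic_blocks n.+1) by [].
pose u n : R := 1 - q%:R * (2 / n.+1%:R).
have dim_ge n : ((u n)%:E <= dim_meas (distribution P (X n)))%E.
  exact: (dim_masked_expansion_ge hb hq (ltn0Sn n) P1 hP (XE n)).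
have dim_le n : (dim_meas (distribution P (X n)) <= 1)%E.
  exact: (dim_masked_expansion_le P b1 (XE n)).
have u_cvg : u n @[n --> \oo] --> (1 : R).
  rewrite -[X in _ --> X]subr0; apply: cvgB; first exact: cvg_cst.
  rewrite -[X in _ --> X](mulr0 (q%:R * 2)).
  rewrite (_ : (fun n => _) = (fun n => q%:R * 2 * harmonic n)); last first.
    by apply/funext => n; rewrite /= mulrA.
  by apply: cvgM; [exact: cvg_cst|exact: cvg_harmonic].
exists (fun n => distribution P (X n)); split.
  apply: (@squeeze_cvge _ _ _ _ (fun n => (u n)%:E) _ (cst 1%E)).
  - by apply: nearW => n; rewrite dim_ge dim_le.
  - by apply: cvg_EFin; [apply: nearW => n //|exact: u_cvg].
  - exact: cvg_cst.
move=> nu _ inv nu0 nu1.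
have nufin : dim_meas nu \is a fin_num.
  by rewrite ge0_fin_numE ?ltW // (lt_trans nu1) // ltry.
have d0 : 0 < fine (dim_meas nu) by rewrite -lte_fin fineK.
have hd : 1 - fine (dim_meas nu) < 1 by rewrite gtrBl.
(* Eventually [u n > 1 - dim nu], so the two dimensions add up to more than 1 and it remains to
   bound the convolution's dimension strictly below 1. *)
have [M _ hM] := cvgr_gt _ u_cvg _ hd; exists M => // n /hM un.
rewrite /resonate lt_min; apply/andP; split; first exact: (dim_convolution_lt1 P hb (ltn0Sn n) (XE n)).
apply: (@lt_le_trans _ _ 1%E); first exact: (dim_convolution_lt1 P hb (ltn0Sn n) (XE n)).
apply: (@le_trans _ _ ((u n)%:E + dim_meas nu)%E); last by rewrite leeD2r.
by rewrite -(fineK nufin) -EFinD lee_fin -lerBlDr ltW.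
Qed.
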